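(* If $G$ is an outerplanar graph with maximum degree $\Delta(G)\geq 4$, then $\chi^1_i(G)=\Delta(G)$.
   Context: All graphs are simple. An outerplanar graph is a graph that can be embedded in the plane with all vertices on the outer face. For a graph $G$, an incidence is a pair $(v,e)$ with $v\in V(G)$ an endpoint of the edge $e\in E(G)$; $I(G)$ is the set of all incidences. For $u\in V(G)$ and a neighbor $v$ of $u$, $(u,uv)$ is a strong incidence of $u$ and $(v,uv)$ is a weak incidence of $u$; $I_u$ and $A_u$ denote the sets of strong and weak incidences of $u$. For a map $\varphi$ on $I(G)$, $\varphi(I_u)=\{\varphi(u,uv): v\in N_G(u)\}$. Let $[k]=\{1,\dots,k\}$. A $d$-defective incidence $k$-coloring of $G$ is a map $\varphi: I(G)\to[k]$ such that for every $u\in V(G)$: (a) $\varphi(u,uv)\neq\varphi(u,uw)$ for distinct $v,w\in N_G(u)$; (b) $\varphi(u,uv)\neq\varphi(v,uv)$ for every $v\in N_G(u)$; (c) every color in $\varphi(I_u)$ appears at most $d$ times among the incidences of $A_u$. $\chi^d_i(G)$ is the minimum $k$ such that $G$ has a $d$-defective incidence $k$-coloring. *)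

(* Defs.v *)
From HB Require Import structures.
From mathcomp Require Import all_boot all_order all_algebra.
From mathcomp Require Import boolp classical_sets set_interval reals topology.
From mathcomp Require Import normedtype.

Set Implicit Arguments.
Unset Strict Implicit.
Unset Printing Implicit Defensive.

Import Order.TTheory GRing.Theory Num.Theory.
Import numFieldNormedType.Exports.

Record sgraph := SGraph {
  vertex :> finType;
  adj : rel vertex;
  adj_sym : symmetric adj;
  adj_irr : irreflexive adj
}.

Arguments adj {s}.

Definition neighbors (G : sgraph) (u : G) : {set G} := [set v | adj u v]%SET.

Definition max_degree (G : sgraph) : nat := \max_(u : G) #|neighbors u|.

Section Plane.
Local Open Scope ring_scope.
Local Open Scope classical_set_scope.
Variables (R : realType) (G : sgraph).

(* The edge uv is drawn as the curve [arc u v] from u to v, parametrized by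
   [0, 1]; [arc v u] is the same curve run backwards. The values of [arc u v]
   outside [0, 1], or for non-adjacent u and v, are irrelevant. *)
Record plane_embedding := PlaneEmbedding {
  pos : G -> (R * R)%type;
  arc : G -> G -> R -> (R * R)%type;
  pos_inj : injective pos;
  arc_rev : forall u v : G, adj u v ->
    forall t : R, 0 <= t <= 1 -> arc v u t = arc u v (1 - t);
  arc_continuous : forall u v : G, adj u v ->
    {within `[0, 1], continuous (arc u v)};
  arc_inj : forall u v : G, adj u v ->
    forall s t : R, 0 <= s <= 1 -> 0 <= t <= 1 -> arc u v s = arc u v t -> s = t;
  arc_source : forall u v : G, adj u v -> arc u v 0 = pos u;
  arc_target : forall u v : G, adj u v -> arc u v 1 = pos v;
  arc_pos_disjoint : forall u v w : G, adj u v ->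
    forall t : R, 0 < t < 1 -> arc u v t <> pos w;
  arc_arc_disjoint : forall u v x y : G, adj u v -> adj x y ->
    [set u; v]%SET != [set x; y]%SET ->
    forall s t : R, 0 < s < 1 -> 0 < t < 1 -> arc u v s <> arc x y t
}.

Definition drawing (f : plane_embedding) : set (R * R) :=
  [set p | (exists v : G, p = pos f v) \/
           (exists u v : G, adj u v /\
              exists2 t : R, 0 <= t <= 1 & p = arc f u v t)].

Definition face (f : plane_embedding) (F : set (R * R)) : Prop :=
  exists2 p, (~` drawing f) p & F = connected_component (~` drawing f) p.

Definition outer_face (f : plane_embedding) (F : set (R * R)) : Prop :=
  face f F /\ ~ bounded_set F.

(* A vertex never belongs to a face, which is a part of the complement of the
   drawing; it lies on a face when it lies on the boundary of that face. *)
Definition outerplanar : Prop :=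
  exists f : plane_embedding, exists2 F, outer_face f F &
    forall v : G, closure F (pos f v).

End Plane.

Section Incidences.
Variable G : sgraph.

Definition edges : {set {set G}} :=
  [set [set p.1; p.2] | p : G * G & adj p.1 p.2].

Definition incidences : {set G * {set G}} :=
  [set i | (i.2 \in edges) && (i.1 \in i.2)].

Definition strong_incidences (u : G) : {set G * {set G}} :=
  [set (u, [set u; v]) | v in neighbors u].

Definition weak_incidences (u : G) : {set G * {set G}} :=
  [set (v, [set u; v]) | v in neighbors u].

(* The values of phi outside [incidences] are irrelevant. *)
Definition defective_incidence_coloring (d k : nat)
    (phi : G * {set G} -> nat) : Prop :=
  (forall i, i \in incidences -> 1 <= phi i <= k) /\
  forall u : G,
    [/\ forall v w, v \in neighbors u -> w \in neighbors u -> v != w ->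
          phi (u, [set u; v]) != phi (u, [set u; w]),
        forall v, v \in neighbors u ->
          phi (u, [set u; v]) != phi (v, [set u; v]) &
        forall c, c \in [seq phi i | i in strong_incidences u] ->
          #|[set j in weak_incidences u | phi j == c]| <= d].

Definition defective_incidence_colorable (d k : nat) : Prop :=
  exists phi, defective_incidence_coloring d k phi.

Lemma defective_incidence_colorable_ex (d : nat) :
  exists k, `[< defective_incidence_colorable d k >].
Proof.
exists #|{: G * {set G}}|; apply/asboolP.
pose phi (i : G * {set G}) := (enum_rank i).+1.
have phi_inj : injective phi by move=> i j [/val_inj/enum_rank_inj].
exists phi; split=> [i _|u]; first by rewrite /phi /= ltn_ord.
split.
- move=> v w _ _; apply: contraNneq => /phi_inj [] Evw.
  have : w \in [set u; v] by rewrite Evw set22.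
  have : v \in [set u; w] by rewrite -Evw set22.
  by rewrite !inE => /orP [/eqP -> /orP [] /eqP -> | /eqP ->].
- move=> v; rewrite inE => uv; apply/eqP => /phi_inj [] Euv.
  by rewrite Euv adj_irr in uv.
move=> c /mapP [i]; rewrite mem_enum => /imsetP [v uv Ei] Ec; rewrite {c}Ec {i}Ei.
apply: leq_trans (leq0n d); rewrite leqn0 cards_eq0.
apply/eqP/setP => j; rewrite !inE; apply/negP => /andP [].
case/imsetP => w uw -> /eqP/phi_inj [] Ewu _.
by move: uw; rewrite inE Ewu adj_irr.
Qed.

Definition defective_incidence_chromatic_number (d : nat) : nat :=
  ex_minn (defective_incidence_colorable_ex d).

End Incidences.

(* Main.v *)
Require Import Defs.
From mathcomp Require Import all_boot all_order all_algebra.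
From mathcomp Require Import reals zify.

Set Implicit Arguments.
Unset Strict Implicit.
Unset Printing Implicit Defensive.

(**
Fix k >= 4 colors and color the arcs: [c u v] is the color of the incidence
(u, uv). We ask for more than the definition does: the arcs leaving a vertex,
the arcs entering a vertex, and the two arcs of an edge get distinct colors.

Such a coloring exists for every graph of maximum degree at most k in which
every nonempty set of vertices has a member with at most two neighbors in the
set. Among the vertices of degree at least 3, choose z with at most two
neighbors of degree at least 3, detach up to three neighbors of degree at most
2 from z, color the rest by induction, and color the detached edges again. The
detached neighbors v1 and v2 must not both forbid the same color, which is
forced by identifying them before using the induction hypothesis. For k = 4 the
color of an arc determines that of the opposite arc through an involution.

If the degeneracy condition fails, some induced subgraph has minimum degree 3;
a longest path in it whose first chord is as short as possible yields a
subdivided K4. In an outerplanar drawing, a point of the outer face can be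
joined to the four branch vertices, which gives a drawing of K5 whose
independent edges are disjoint. Sampling the curves finely enough, let K(u; f)
be the parity of the number of times that the vector from u to a point moving
along f crosses a fixed half-line. If e from u to u' and f from a to b are
disjoint, then the parity K(u; f) + K(u'; f) + K(a; e) + K(b; e) depends on the
four end points only, since each cell of the grid e x f contributes trivially.
Summed over the 15 pairs of independent edges of K5, each K(u; f) occurs twice,
but the end point terms add up to an odd number.
*)

(** * Colorings of arcs *)

Section ArcColorings.
Variables (C : finType) (P : rel C).
Hypotheses (P_sym : symmetric P) (P_neq : forall x y, P x y -> x != y).

Definition avoids (F : seq (C * C)) (q : C * C) : bool :=
  (q.1 \notin unzip1 F) && (q.2 \notin unzip2 F).

Definition differ (a b : C * C) : bool := (a.1 != b.1) && (a.2 != b.2).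

Definition compatible (o : option (C * C)) (q : C * C) : bool :=
  if o is Some a then differ q a else true.

Definition nbr (T : finType) (e : rel T) (v : T) : {set T} := [set w | e v w].

Definition two_degenerate (T : finType) (e : rel T) : Prop :=
  forall A : {set T}, A != set0 ->
  exists2 v, v \in A & #|[set w in A | e v w]| <= 2.

(** [P] relates the two colors of an edge. It is inequality when there are more than four colors,
    and the graph of an involution without fixed points when there are four. *)
Definition arc_coloring (T : finType) (e : rel T) (c : T -> T -> C) : Prop :=
  (forall u v, e u v -> P (c u v) (c v u)) /\
  (forall u v w, e u v -> e u w -> v != w -> c u v != c u w /\ c v u != c w u).

(** Every condition concerns one edge or two edges with a common end, so injectivity of [f] on each
    neighborhood is enough. *)
Lemma arc_coloring_pullback (T T' : finType) (e : rel T) (e' : rel T')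
    (f : T -> T') (c : T' -> T' -> C) :
  (forall u v, e u v -> e' (f u) (f v)) ->
  (forall u v w, e u v -> e u w -> v != w -> f v != f w) ->
  arc_coloring e' c -> arc_coloring e (fun u v => c (f u) (f v)).
Proof.
move=> f_hom f_inj [cP c_inj]; split=> [u v /f_hom/cP //|u v w uv uw vw].
by apply: c_inj; [exact: f_hom | exact: f_hom | exact: f_inj uv uw vw].
Qed.

Definition cut (T : finType) (e : rel T) (z : T) (V : {set T}) : rel T :=
  fun u w => e u w && ~~ ((u == z) && (w \in V) || (w == z) && (u \in V)).

(* [q v] is the pair of colors given to the arcs zv and vz. *)
Lemma arc_coloring_extend (T : finType) (e : rel T) (z : T) (V : {set T})
    (c : T -> T -> C) (q : T -> C * C) :
  symmetric e -> irreflexive e -> V \subset nbr e z ->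
  arc_coloring (cut e z V) c ->
  (forall v, v \in V -> P (q v).1 (q v).2) ->
  (forall v w, v \in V -> w \in V -> v != w ->
     (q v).1 != (q w).1 /\ (q v).2 != (q w).2) ->
  (forall v w, v \in V -> w \in nbr e z :\: V ->
     (q v).1 != c z w /\ (q v).2 != c w z) ->
  (forall v x, v \in V -> e v x -> x != z ->
     (q v).1 != c x v /\ (q v).2 != c v x) ->
  exists c', arc_coloring e c'.
Proof.
move=> e_sym e_irr /subsetP Vz; rewrite /arc_coloring /cut => -[cP c_inj] qP q_inj qz qx.
have zV v : v \in V -> v != z.
  by move=> /Vz; rewrite inE; apply: contraTneq => ->; rewrite e_irr.
have zz : z \in V = false by apply/negP => /zV/eqP.
exists (fun u w => if (u == z) && (w \in V) then (q w).1
                   else if (w == z) && (u \in V) then (q u).2 else c u w).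
split=> [u v uv|u v w uv uw vw].
  case: ifP => [/andP [/eqP uz vV]|h1].
    rewrite uz (negPf (zV _ vV)); exact: qP.
  case: ifP => [/andP [/eqP vz uV]|h2].
    by rewrite P_sym; apply: qP.
  by apply: cP; rewrite uv h1 h2.
have [uz|uz] := altP (u =P z).
  subst u; rewrite zz /= !andbF /=.
  have [vV|vV] := boolP (v \in V); have [wV|wV] := boolP (w \in V).
  - exact: q_inj.
  - by apply: qz => //; rewrite inE wV inE.
  - by case: (qz w v) => //; rewrite ?inE ?vV // eq_sym => -> ; rewrite eq_sym.
  - by apply: c_inj => //; rewrite ?uv ?uw /= ?(negPf vV) ?(negPf wV) ?zz ?andbF.
rewrite /=.
have [uV|uV] := boolP (u \in V); last first.
  rewrite !andbF; apply: c_inj => //; rewrite ?uv ?uw (negPf uz) (negPf uV) /= ?andbF //.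
rewrite !andbT.
have [vz|vz] := altP (v =P z); have [wz|wz] := altP (w =P z) => //=.
- by rewrite vz wz eqxx in vw.
- by case: (qx u w).
- by case: (qx u v) => //; rewrite eq_sym => ->; rewrite eq_sym.
by apply: c_inj => //; rewrite ?uv ?uw (negPf uz) ?(negPf vz) ?(negPf wz).
Qed.

(** Ordered pairs, so an edge counts twice. The induction on graphs is on the number of arcs. *)
Definition arcs (T : finType) (e : rel T) : {set T * T} := [set p | e p.1 p.2].

Lemma cut_sub (T : finType) (e : rel T) z V : subrel (cut e z V) e.
Proof. by move=> u w /andP []. Qed.

Lemma cut_sym (T : finType) (e : rel T) z V :
  symmetric e -> symmetric (cut e z V).
Proof. by move=> e_sym u w; rewrite /cut e_sym orbC. Qed.

Lemma two_degenerate_sub (T : finType) (e e' : rel T) :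
  subrel e' e -> two_degenerate e -> two_degenerate e'.
Proof.
move=> e'e e2 A /e2 [v vA ev]; exists v => //; apply: leq_trans ev.
by apply: subset_leq_card; apply/subsetP => w; rewrite !inE => /andP [-> /e'e].
Qed.

Lemma nbr_sub (T : finType) (e e' : rel T) v :
  subrel e' e -> nbr e' v \subset nbr e v.
Proof. by move=> e'e; apply/subsetP => w; rewrite !inE => /e'e. Qed.

Lemma low_neighbor_uniq (T : finType) (e : rel T) v z x y :
  #|nbr e v| <= 2 -> e v z -> e v x -> e v y -> x != z -> y != z -> x = y.
Proof.
move=> v2 vz vx vy xz yz; apply/eqP/negP => /negP xy.
suff: #|[set z; x; y]| <= 2.
  by rewrite -setUA cardsU1 cards2 !inE negb_or xy eq_sym xz eq_sym yz.
apply: leq_trans v2; apply: subset_leq_card; apply/subsetP => w.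
by rewrite !inE => /orP [/orP [] | ] /eqP ->.
Qed.

(** * Detaching low-degree neighbors of a vertex *)

Section Reduction.
Variables (T : finType) (e : rel T) (k : nat) (z : T) (V : {set T}).
Hypotheses (e_sym : symmetric e) (e_irr : irreflexive e).
Hypotheses (e_deg : forall v, #|nbr e v| <= k) (e_2deg : two_degenerate e).
Hypothesis k_ge2 : 2 <= k.
Hypotheses (Vz : V \subset nbr e z) (V_low : forall v, v \in V -> #|nbr e v| <= 2).
Hypothesis IH : forall e' : rel T,
  symmetric e' -> irreflexive e' -> (forall v, #|nbr e' v| <= k) ->
  two_degenerate e' -> #|arcs e'| < #|arcs e| -> exists c, arc_coloring e' c.

Lemma low_adj v : v \in V -> e v z.
Proof. by move/(subsetP Vz); rewrite inE e_sym. Qed.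

Lemma low_neq v : v \in V -> v != z.
Proof. by move/low_adj; apply: contraTneq => ->; rewrite e_irr. Qed.

Lemma cut_low v x : v \in V -> cut e z V v x = e v x && (x != z).
Proof. by move=> vV; rewrite /cut (negPf (low_neq vV)) vV andbT. Qed.

Lemma cut_coloring : V != set0 -> exists c, arc_coloring (cut e z V) c.
Proof.
case/set0Pn => v vV; apply: IH.
- exact: cut_sym.
- by move=> u; rewrite /cut e_irr.
- by move=> u; apply: leq_trans (e_deg u); apply/subset_leq_card/nbr_sub/cut_sub.
- by apply: two_degenerate_sub e_2deg; apply: cut_sub.
apply: proper_card; apply/properP; split.
  by apply/subsetP => p; rewrite !inE => /cut_sub.
by exists (v, z); rewrite !inE /= ?cut_low ?low_adj // eqxx andbF.
Qed.

(** In the cut graph [v1] and [v2] have at most one neighbor each, [x1] and [x2]. If both exist, are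
    distinct, and [v1], [v2] are not adjacent, then [v1] is identified with [v2]: the two edges now
    share an end, which separates their colors. Otherwise any coloring of the cut graph will do. *)
Lemma separated_coloring v1 v2 : v1 \in V -> v2 \in V -> v1 != v2 ->
  exists2 c, arc_coloring (cut e z V) c &
    forall x1 x2, cut e z V v1 x1 -> cut e z V v2 x2 ->
      c x1 v1 != c x2 v2 /\ c v1 x1 != c v2 x2.
Proof.
move=> v1V v2V v12.
have V0 : V != set0 by apply/set0Pn; exists v1.
have v1z := low_neq v1V; have v2z := low_neq v2V.
have uniq1 x y : cut e z V v1 x -> cut e z V v1 y -> x = y.
  rewrite !cut_low // => /andP [ex xz] /andP [ey yz].
  exact: low_neighbor_uniq (V_low v1V) (low_adj v1V) ex ey xz yz.
have uniq2 x y : cut e z V v2 x -> cut e z V v2 y -> x = y.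
  rewrite !cut_low // => /andP [ex xz] /andP [ey yz].
  exact: low_neighbor_uniq (V_low v2V) (low_adj v2V) ex ey xz yz.
have csym := cut_sym z V e_sym.
have [x1 vx1|no1] := pickP (cut e z V v1); last first.
  by have [c c_ok] := cut_coloring V0; exists c => // x x2; rewrite no1.
have [x2 vx2|no2] := pickP (cut e z V v2); last first.
  by have [c c_ok] := cut_coloring V0; exists c => // x x'; rewrite no2.
(* If [v1] and [v2] are adjacent, both edges are the same edge read in opposite directions, and
   [P_neq] separates its colors. *)
have [x1v2|x1v2] := eqVneq x1 v2.
  have [c c_ok] := cut_coloring V0; exists c => // y1 y2 /uniq1 - /(_ _ vx1) ->.
  move=> /uniq2 - /(_ v1); rewrite csym -{1}x1v2 => /(_ vx1) ->; rewrite x1v2.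
  have := P_neq (c_ok.1 _ _ vx1); rewrite x1v2 => ne; split=> //.
  by rewrite eq_sym.
have [x12|x12] := eqVneq x1 x2.
  have [c c_ok] := cut_coloring V0; exists c => // y1 y2 /uniq1 - /(_ _ vx1) ->.
  move=> /uniq2 - /(_ _ vx2) ->; rewrite -x12.
  have := c_ok.2 x1 v1 v2; rewrite csym vx1 csym x12 vx2 => /(_ isT isT v12).
  by [].
have x1v1 : x1 != v1.
  by apply: contraTneq vx1 => ->; rewrite /cut e_irr.
(* The cut graph with [v1] deleted and its edge to [x1] attached to [v2] instead. *)
pose e' u w := [&& u != v1, w != v1 &
  [|| cut e z V u w, (u == v2) && (w == x1) | (u == x1) && (w == v2)]].
have e'_cut u w : u != v2 -> w != v2 -> e' u w -> cut e z V u w.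
  move=> uv2 wv2; rewrite /e' (negPf uv2) (negPf wv2) andbF !orbF.
  by case/and3P.
pose f u := if u == v1 then v2 else u.
have [||||| c c_ok] := IH (e' := e').
- by move=> u w; rewrite /e' csym [(u == v2) && _]andbC [(u == x1) && _]andbC;
    rewrite [((w == x1) && _) || _]orbC; case: (u != v1); rewrite /= ?andbF.
- move=> u; apply/negP => /and3P [_ _]; rewrite /cut e_irr /=.
  by case/orP => /andP [/eqP Eu /eqP Eu']; move: x1v2; rewrite -Eu -Eu' eqxx.
- move=> u; have [->|uv2] := eqVneq u v2.
    apply: leq_trans k_ge2; apply: (@leq_trans #|[set x1; x2]|); last first.
      by rewrite cards2 x12.
    apply/subset_leq_card/subsetP => w; rewrite !inE /e' => /and3P [_ _].
    case/or3P => [/uniq2/(_ vx2) ->|/andP [_ ->]|/andP [/eqP E _]] //.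
    + by rewrite eqxx orbT.
    + by rewrite E eqxx in x1v2.
  have [->|ux1] := eqVneq u x1.
    apply: leq_trans (e_deg x1).
    rewrite (cardsD1 v1 (nbr e x1)) inE e_sym (cut_sub vx1).
    apply: (@leq_trans #|v2 |: (nbr e x1 :\ v1)|); last first.
      by rewrite cardsU1 leq_add2r leq_b1.
    apply/subset_leq_card/subsetP => w; rewrite !inE /e' => /and3P [_ -> ].
    case/or3P => [/cut_sub ->|/andP [/eqP E]|/andP [_ ->]] //; rewrite ?orbT //.
    by rewrite E eqxx in x1v2.
  apply: leq_trans (e_deg u); apply/subset_leq_card/subsetP => w.
  rewrite !inE /e' (negPf uv2) (negPf ux1) !orbF => /and3P [_ _].
  exact: cut_sub.
(* The merged vertex [v2] has at most two neighbors, so it serves for every set containing it; the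
   other sets see only edges of the cut graph. *)
- move=> A A0; have [v2A|v2A] := boolP (v2 \in A).
    exists v2 => //; apply: (@leq_trans #|[set x1; x2]|); last first.
      by rewrite cards2 x12.
    apply/subset_leq_card/subsetP => w; rewrite !inE /e' => /and4P [_ _ _].
    case/or3P => [/uniq2/(_ vx2) ->|/andP [_ ->]|/andP [/eqP E _]] //.
    + by rewrite eqxx orbT.
    + by rewrite E eqxx in x1v2.
  have [v vA ev] := e_2deg A0; exists v => //; apply: leq_trans ev.
  apply/subset_leq_card/subsetP => w; rewrite !inE => /andP [wA].
  rewrite wA => /e'_cut/cut_sub -> //.
    by apply: contraNneq v2A => <-.
  by apply: contraNneq v2A => <-.
(* At most the two arcs of [D] are gained, while the three arcs of [B] are lost. *)
- pose D := [set (v2, x1); (x1, v2)].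
  pose B := [set (z, v1); (z, v2); (v1, z)].
  have B3 : #|B| = 3.
    by rewrite /B -setUA cardsU1 cards2 !inE !xpair_eqE (negPf v12)
      ![z == v1]eq_sym (negPf v1z) !andbF.
  have B_e : B \subset arcs e.
    apply/subsetP => p; rewrite !inE => /orP [/orP [] |] /eqP -> /=; rewrite ?low_adj //;
    by rewrite e_sym low_adj.
  apply: (@leq_ltn_trans #|D :|: (arcs e :\: B)|).
    apply/subset_leq_card/subsetP => -[u w]; rewrite !inE !xpair_eqE /e' /=.
    case/and3P => uv1 wv1 /or3P [uw|->|->]; rewrite ?orbT //.
    rewrite (cut_sub uw) (negPf uv1) (negPf wv1) !andbF !orbF andbT.
    apply/orP; right; apply: contraTN uw => /andP [/eqP -> /eqP ->].
    by rewrite /cut v2V eqxx andbF.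
  apply: (leq_ltn_trans (leq_card_setU _ _)).
  rewrite cards2 -(cardsID B (arcs e)) (setIidPr B_e) B3 ltn_add2r.
  by case: (_ != _).
exists (fun u w => c (f u) (f w)).
  (* Injectivity on neighborhoods could fail only at a common neighbor of [v1] and [v2], which
     [x1 != x2] excludes. *)
  apply: (@arc_coloring_pullback _ _ _ e') => // [u w uw|u v w uv uw vw].
    rewrite /e' /f; have [Eu|uv1] := eqVneq u v1; have [Ew|wv1] := eqVneq w v1.
    + by move: uw; rewrite Eu Ew /cut e_irr.
    + rewrite eq_sym v12 wv1 /=; move: uw; rewrite Eu => /uniq1 - /(_ _ vx1) ->.
      by rewrite !eqxx orbT.
    + rewrite uv1 eq_sym v12 /=; move: uw; rewrite Ew csym => /uniq1 - /(_ _ vx1) ->.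
      by rewrite !eqxx !orbT.
    + by rewrite uv1 wv1 uw.
  rewrite /f; have [Ev|vv1] := eqVneq v v1; have [Ew|wv1] := eqVneq w v1 => //.
  + by rewrite Ev Ew eqxx in vw.
  + apply: contraNneq x12 => Ew; move: uv uw; rewrite Ev -Ew csym [cut _ _ _ u _]csym.
    by move=> /uniq1 - /(_ _ vx1) <- /uniq2 - /(_ _ vx2) <-.
  + apply: contraNneq x12 => Ev; move: uv uw; rewrite Ew Ev csym [cut _ _ _ u _]csym.
    by move=> /uniq2 - /(_ _ vx2) <- /uniq1 - /(_ _ vx1) <-.
move=> y1 y2 /uniq1 - /(_ _ vx1) -> /uniq2 - /(_ _ vx2) ->.
have x2v1 : x2 != v1.
  apply: contraNneq x1v2 => Ex2; move: vx2; rewrite Ex2 csym.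
  by move=> /uniq1 - /(_ _ vx1) ->.
have [|||h1 h2] := c_ok.2 v2 x1 x2 => //.
- by rewrite /e' eq_sym v12 x1v1 !eqxx orbT.
- by rewrite /e' eq_sym v12 vx2 /= andbT.
by rewrite /f eqxx (negPf x1v1) [v2 == v1]eq_sym (negPf v12) (negPf x2v1).
Qed.

(** The arc entering [v] comes first, as in the pair chosen for the edge from [z] to [v], so that
    conflicts at [v] are componentwise. *)
Definition other_pair (c : T -> T -> C) (v : T) : option (C * C) :=
  omap (fun x => (c x v, c v x)) [pick x | cut e z V v x].

Definition fixed_pairs (c : T -> T -> C) : seq (C * C) :=
  [seq (c z w, c w z) | w <- enum (nbr e z :\: V)].

Lemma other_pair_cut c v a : other_pair c v = Some a ->
  exists2 x, cut e z V v x & a = (c x v, c v x).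
Proof. by rewrite /other_pair; case: pickP => // x vx [<-]; exists x. Qed.

Lemma extend_coloring c (q : T -> C * C) :
  arc_coloring (cut e z V) c ->
  (forall v, v \in V -> [/\ P (q v).1 (q v).2, avoids (fixed_pairs c) (q v)
                        & compatible (other_pair c v) (q v)]) ->
  {in V &, forall v w, v != w -> differ (q v) (q w)} ->
  exists c', arc_coloring e c'.
Proof.
move=> c_ok q_ok q_inj; apply: (arc_coloring_extend e_sym e_irr Vz c_ok (q := q)).
- by move=> v /q_ok [].
- by move=> v w vV wV vw; apply/andP/q_inj.
- move=> v w /q_ok [_ /andP [q1 q2] _] wV; split.
    apply: contraNneq q1 => ->; apply/mapP; exists (c z w, c w z) => //.
    by apply/mapP; exists w; rewrite ?mem_enum.
  apply: contraNneq q2 => ->; apply/mapP; exists (c z w, c w z) => //.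
  by apply/mapP; exists w; rewrite ?mem_enum.
- move=> v x vV vx xz; have [_ _] := q_ok v vV; rewrite /other_pair.
  case: pickP => [y|/(_ x)]; last by rewrite cut_low // vx xz.
  rewrite cut_low // => /andP [vy yz].
  rewrite (low_neighbor_uniq (V_low vV) (low_adj vV) vx vy xz yz).
  by move=> /andP [].
Qed.

Lemma fixed_pairs_rel c : arc_coloring (cut e z V) c ->
  {in fixed_pairs c, forall a, P a.1 a.2}.
Proof.
move=> [cP _] a /mapP [w]; rewrite mem_enum !inE => /andP [wV zw] -> /=.
have zV : z \notin V by apply/negP => /low_neq/eqP.
by apply: cP; rewrite /cut zw (negPf wV) (negPf zV) !andbF.
Qed.

Lemma size_fixed_pairs c : size (fixed_pairs c) = #|nbr e z| - #|V|.
Proof. by rewrite size_map -cardE cardsDS. Qed.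

Lemma other_pair_rel c v : arc_coloring (cut e z V) c ->
  forall a, other_pair c v = Some a -> P a.1 a.2.
Proof. by move=> [cP _] a /other_pair_cut [x vx ->]; rewrite P_sym; apply: cP. Qed.

Lemma separated_other_pairs v1 v2 : v1 \in V -> v2 \in V -> v1 != v2 ->
  exists2 c, arc_coloring (cut e z V) c &
    forall a b, other_pair c v1 = Some a -> other_pair c v2 = Some b -> differ a b.
Proof.
move=> v1V v2V v12; have [c c_ok c_sep] := separated_coloring v1V v2V v12.
exists c => // a b /other_pair_cut [x1 vx1 ->] /other_pair_cut [x2 vx2 ->].
by apply/andP/c_sep.
Qed.

End Reduction.

(** * Extension properties of the colors and the induction *)

Definition two_extendable : Prop :=
  forall (F : seq (C * C)) (o1 o2 : option (C * C)),
  size F <= 2 -> {in F, forall a, P a.1 a.2} ->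
  (forall a, o1 = Some a -> P a.1 a.2) -> (forall a, o2 = Some a -> P a.1 a.2) ->
  (forall a b, o1 = Some a -> o2 = Some b -> differ a b) ->
  exists q1 q2,
    [/\ P q1.1 q1.2, avoids F q1 & compatible o1 q1] /\
    [/\ P q2.1 q2.2, avoids F q2 & compatible o2 q2] /\ differ q1 q2.

(** Separation is assumed for the first two items only, because the identification of vertices
    secures it for a single pair. *)
Definition three_extendable : Prop :=
  forall (F : seq (C * C)) (o1 o2 o3 : option (C * C)),
  size F <= #|C| - 3 -> {in F, forall a, P a.1 a.2} ->
  (forall a, o1 = Some a -> P a.1 a.2) -> (forall a, o2 = Some a -> P a.1 a.2) ->
  (forall a, o3 = Some a -> P a.1 a.2) ->
  (forall a b, o1 = Some a -> o2 = Some b -> differ a b) ->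
  exists q1 q2 q3,
    [/\ P q1.1 q1.2, avoids F q1 & compatible o1 q1] /\
    [/\ P q2.1 q2.2, avoids F q2 & compatible o2 q2] /\
    [/\ P q3.1 q3.2, avoids F q3 & compatible o3 q3] /\
    [/\ differ q1 q2, differ q1 q3 & differ q2 q3].

Lemma differ_sym a b : differ a b = differ b a.
Proof. by rewrite /differ ![b.1 == _]eq_sym ![b.2 == _]eq_sym. Qed.

(** One, two or three low neighbors of [z] are detached when its degree is at most 3, equal to 4, or
    at least 5. At most two edges at [z] keep their colors in the first two cases, and at most
    [#|C| - 3] in the last. *)
Lemma two_degenerate_arc_coloring :
  4 <= #|C| -> two_extendable -> (4 < #|C| -> three_extendable) ->
  forall (T : finType) (e : rel T),
  symmetric e -> irreflexive e -> (forall v, #|nbr e v| <= #|C|) ->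
  two_degenerate e -> exists c, arc_coloring e c.
Proof.
move=> C4 ext2 ext3 T e.
have [n] := ubnP #|arcs e|; elim: n e => // n IHn e e_n e_sym e_irr e_deg e_2deg.
have IH (e' : rel T) : symmetric e' -> irreflexive e' ->
    (forall v, #|nbr e' v| <= #|C|) -> two_degenerate e' ->
    #|arcs e'| < #|arcs e| -> exists c, arc_coloring e' c.
  by move=> s i d t lt; apply: IHn => //; apply: leq_trans lt _.
have C2 : 2 <= #|C| by apply: leq_trans C4.
have one z v : e z v -> #|nbr e v| <= 2 -> #|nbr e z| <= 3 ->
    exists c, arc_coloring e c.
  move=> zv v_low z3; pose V := [set v].
  have Vz : V \subset nbr e z by rewrite sub1set inE.
  have V_low w : w \in V -> #|nbr e w| <= 2 by rewrite inE => /eqP ->.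
  have [|c c_ok] := cut_coloring e_sym e_irr e_deg e_2deg Vz IH.
    by apply/set0Pn; exists v; rewrite inE.
  (* A single detached edge is treated as the first of two, the second being unconstrained and then
     discarded. *)
  have [|||||q1 [q2 [q1_ok _]]] := ext2 (fixed_pairs e z V c) (other_pair e z V c v) None.
  - by rewrite (size_fixed_pairs Vz) cards1 leq_subLR.
  - exact: fixed_pairs_rel.
  - exact: other_pair_rel.
  - by [].
  - by [].
  apply: (extend_coloring e_sym e_irr Vz V_low c_ok (q := fun=> q1)).
    by move=> w; rewrite inE => /eqP ->.
  by move=> w w'; rewrite !inE => /eqP -> /eqP ->; rewrite eqxx.
have two z v1 v2 : e z v1 -> e z v2 -> v1 != v2 -> #|nbr e v1| <= 2 ->
    #|nbr e v2| <= 2 -> #|nbr e z| <= 4 -> exists c, arc_coloring e c.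
  move=> zv1 zv2 v12 low1 low2 z4; pose V := [set v1; v2].
  have Vz : V \subset nbr e z by rewrite subUset !sub1set !inE zv1.
  have V_low w : w \in V -> #|nbr e w| <= 2 by rewrite !inE => /orP [] /eqP ->.
  have v1V : v1 \in V by rewrite !inE eqxx.
  have v2V : v2 \in V by rewrite !inE eqxx orbT.
  have [c c_ok c_sep] :=
    separated_other_pairs e_sym e_irr e_deg e_2deg C2 Vz V_low IH v1V v2V v12.
  have [||||| q1 [q2 [q1_ok [q2_ok q12]]]] := ext2 (fixed_pairs e z V c)
    (other_pair e z V c v1) (other_pair e z V c v2).
  - by rewrite (size_fixed_pairs Vz) cards2 v12 leq_subLR.
  - exact: fixed_pairs_rel.
  - exact: other_pair_rel.
  - exact: other_pair_rel.
  - exact: c_sep.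
  apply: (extend_coloring e_sym e_irr Vz V_low c_ok
            (q := fun v => if v == v1 then q1 else q2)).
    move=> w; rewrite !inE; case: eqP => [-> //|_] /eqP -> //.
  move=> w w'; rewrite !inE; case: eqP => [->|_] h; case: eqP => [->|_] h'.
  - by rewrite eqxx.
  - by [].
  - by rewrite differ_sym.
  - by rewrite (eqP h) (eqP h') eqxx.
have three z v1 v2 v3 : e z v1 -> e z v2 -> e z v3 -> v1 != v2 -> v1 != v3 ->
    v2 != v3 -> #|nbr e v1| <= 2 -> #|nbr e v2| <= 2 -> #|nbr e v3| <= 2 ->
    4 < #|nbr e z| -> exists c, arc_coloring e c.
  move=> zv1 zv2 zv3 v12 v13 v23 low1 low2 low3 z5; pose V := [set v1; v2; v3].
  have Vz : V \subset nbr e z by rewrite !subUset !sub1set !inE zv1 zv2.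
  have V_low w : w \in V -> #|nbr e w| <= 2.
    by rewrite !inE => /orP [/orP []|] /eqP ->.
  have v1V : v1 \in V by rewrite !inE eqxx.
  have v2V : v2 \in V by rewrite !inE eqxx orbT.
  have V3 : #|V| = 3 by rewrite /V -setUA cardsU1 cards2 !inE negb_or v12 v13 v23.
  have [c c_ok c_sep] :=
    separated_other_pairs e_sym e_irr e_deg e_2deg C2 Vz V_low IH v1V v2V v12.
  have [|||||||q1 [q2 [q3 [q1_ok [q2_ok [q3_ok [q12 q13 q23]]]]]]] :=
    ext3 _ (fixed_pairs e z V c) (other_pair e z V c v1)
      (other_pair e z V c v2) (other_pair e z V c v3).
  - exact: leq_trans z5 (e_deg z).
  - by rewrite (size_fixed_pairs Vz) V3 leq_sub2r.
  - exact: fixed_pairs_rel.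
  - exact: other_pair_rel.
  - exact: other_pair_rel.
  - exact: other_pair_rel.
  - exact: c_sep.
  apply: (extend_coloring e_sym e_irr Vz V_low c_ok
            (q := fun v => if v == v1 then q1 else if v == v2 then q2 else q3)).
    move=> w; rewrite !inE; case: eqP => [-> //|_]; case: eqP => [-> //|_] /eqP -> //.
  move=> w w'; rewrite !inE; move: v12 v13 v23 => /negPf n12 /negPf n13 /negPf n23.
  by move=> /orP [/orP []|] /eqP -> /orP [/orP []|] /eqP ->;
    rewrite ?eqxx // ![_ == v1]eq_sym ?[v3 == v2]eq_sym ?n12 ?n13 ?n23 // differ_sym.
pose A := [set v | 2 < #|nbr e v|].
have low_notin v : v \notin A -> #|nbr e v| <= 2 by rewrite inE -leqNgt.
(* Without vertices of degree at least 3, any edge can be detached; without edges, a constant map is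
   a coloring. *)
have [A0|A0] := eqVneq A set0.
  have low v : #|nbr e v| <= 2 by apply: low_notin; rewrite A0 inE.
  have [[u v] /= uv|no_edge] := pickP [pred p : T * T | e p.1 p.2].
    by apply: (one u v) => //; apply: leq_trans (low u) _.
  have [x _|C0] := pickP (@predT C); last by rewrite (eq_card0 C0) in C4.
  exists (fun _ _ => x); split=> [u v uv|u v w uv]; have := no_edge (u, v);
    by rewrite /= uv.
have [z zA z2] := e_2deg _ A0.
pose L := nbr e z :\: A.
have L_low v : v \in L -> e z v /\ #|nbr e v| <= 2.
  by rewrite !inE -leqNgt => /andP [].
have L_card : #|nbr e z| <= #|L| + 2.
  rewrite -(cardsID A (nbr e z)) addnC leq_add2l; apply: leq_trans z2.
  by apply/subset_leq_card/subsetP => v; rewrite !inE => /andP [-> ->].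
have z3 : 2 < #|nbr e z| by rewrite inE in zA.
have [z_le3|z_gt3] := leqP #|nbr e z| 3.
  have /card_gt0P [v /L_low [zv v_low]] : 0 < #|L| by lia.
  exact: (one z v).
have [z_le4|z_gt4] := leqP #|nbr e z| 4.
  have /card_gt1P [v1 [v2 [/L_low [zv1 low1] /L_low [zv2 low2] v12]]] : 1 < #|L| by lia.
  exact: (two z v1 v2).
have /card_gt2P [v1 [v2 [v3 [[L1 L2 L3] [v12 v23 v31]]]]] : 2 < #|L| by lia.
have [[zv1 low1] [zv2 low2]] := (L_low _ L1, L_low _ L2).
have [zv3 low3] := L_low _ L3.
by apply: (three z v1 v2 v3) => //; rewrite eq_sym.
Qed.

End ArcColorings.

(** * Choosing the colors of the detached edges *)

Lemma three_extendable_two (C : finType) (P : rel C) :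
  4 < #|C| -> three_extendable P -> two_extendable P.
Proof.
move=> C5 ext3 F o1 o2 F2 F_P o1P o2P o12.
have F3 : size F <= #|C| - 3 by lia.
have o3P (a : C * C) : None = Some a -> P a.1 a.2 by [].
have [q1 [q2 [_ [q1_ok [q2_ok [_ [q12 _ _]]]]]]] := ext3 F o1 o2 None F3 F_P o1P o2P o3P o12.
by exists q1, q2.
Qed.

Lemma card_predC_seq (C : finType) (s : seq C) : #|C| <= #|[predC s]| + size s.
Proof.
by rewrite -(cardC (mem s)) addnC leq_add2l; apply: card_size.
Qed.

(** A pair is determined by its first color, and [F] leaves at least 4 - 2 = 2 first colors. If
    using them in one order conflicts with [o1] or [o2], the other order works because [o1] and [o2]
    differ. *)
Lemma two_extendable_rev_ord : two_extendable [rel x y : 'I_4 | y == rev_ord x].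
Proof.
move=> F o1 o2 F2 F_P o1P o2P o12.
have /card_gt1P [b1 [b2 [b1F b2F b12]]] : 1 < #|[predC unzip1 F]|.
  by have := card_predC_seq (unzip1 F); rewrite card_ord size_map; lia.
pose q (b : 'I_4) := (b, rev_ord b).
have q_avoids b : b \in [predC unzip1 F] -> avoids F (q b).
  rewrite inE /avoids /= => bF; rewrite bF /=; apply: contra bF => /mapP [a aF Ea].
  by apply/mapP; exists a => //; apply: rev_ord_inj; rewrite Ea; apply/eqP/F_P.
have q_inj b b' : b != b' -> differ (q b) (q b').
  by move=> bb'; rewrite /differ /= (inj_eq rev_ord_inj) bb'.
have q_compat o b : (forall a, o = Some a -> a.2 == rev_ord a.1) ->
    compatible o (q b) = if o is Some a then b != a.1 else true.
  case: o => //= a /(_ a erefl) /eqP Ea.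
  by rewrite /differ /= Ea (inj_eq rev_ord_inj) andbb.
suff [c1 [c2 [c1F c2F c12 c1o c2o]]] : exists c1 c2 : 'I_4,
    [/\ c1 \in [predC unzip1 F], c2 \in [predC unzip1 F], c1 != c2,
        compatible o1 (q c1) & compatible o2 (q c2)].
  by exists (q c1), (q c2); rewrite /= !eqxx c1o c2o q_inj // !q_avoids.
have [c1|c1] := boolP (compatible o1 (q b1) && compatible o2 (q b2)).
  by case/andP: c1 => c1 c2; exists b1, b2.
exists b2, b1; rewrite eq_sym; suff /andP [] : compatible o1 (q b2) && compatible o2 (q b1) by [].
move: c1; rewrite !q_compat // negb_and.
case: o1 o2 o12 {o1P o2P} => [a1|] [a2|] o12; rewrite ?negbK //=.
- have /andP [d12 _] := o12 _ _ erefl erefl.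
  case/orP => /eqP E; first by rewrite -E eq_sym b12 E.
  by rewrite -E b12 andbT E eq_sym.
- by rewrite orbF andbT => /eqP <-; rewrite eq_sym.
- by move/eqP <-.
Qed.

(* The colors available for the first arcs, and those available for the second
   arcs, are listed so that the common ones come first, at the same positions
   below [m]. Colors are coded by these positions, with 3 for all others; [p]
   and [r] code the colors forbidden for the two arcs of each item. *)
Definition all_triples (a : pred (seq nat)) : bool :=
  all (fun x => all (fun y => all (fun t => a [:: x; y; t])
    (iota 0 4)) (iota 0 4)) (iota 0 4).

Definition orders : seq (seq nat) :=
  [:: [:: 0; 1; 2]; [:: 0; 2; 1]; [:: 1; 0; 2]; [:: 1; 2; 0]; [:: 2; 0; 1];
      [:: 2; 1; 0]].

(** Equal codes below 3 mean equal colors, whereas code 3 may stand for different colors or for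
    none. Only the first two items are separated. *)
Definition distinct_codes (p : seq nat) : bool :=
  (nth 0 p 0 == 3) || (nth 0 p 0 != nth 0 p 1).

(** Among the first three positions of both lists, the same color occurs twice only at a common
    position below [m]. *)
Definition codes_neq (m x y : nat) : bool := ~~ ((x == y) && (x < m)).

Definition item_ok (m : nat) (p r s t : seq nat) (i : nat) : bool :=
  [&& nth 0 s i != nth 0 p i, nth 0 t i != nth 0 r i &
      codes_neq m (nth 0 s i) (nth 0 t i)].

(** Three available colors per list always suffice, which makes the search finite: [s] and [t]
    assign the positions of the two lists to the three items. *)
Lemma three_items_solvable :
  all_triples (fun p => distinct_codes p ==> all_triples (fun r => distinct_codes r ==>
    all (fun m => all (fun i => codes_neq m (nth 0 p i) (nth 0 r i)) (iota 0 3) ==>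
      has (fun s => has (fun t => all (item_ok m p r s t) (iota 0 3)) orders) orders)
    (iota 0 4))).
Proof. by vm_compute. Qed.

Lemma all_triplesP (a : pred (seq nat)) : all_triples a ->
  forall x y t, x <= 3 -> y <= 3 -> t <= 3 -> a [:: x; y; t].
Proof.
move=> /allP ha x y t x3 y3 t3.
have m i : i <= 3 -> i \in iota 0 4 by rewrite mem_iota.
by have /allP /(_ _ (m y y3)) /allP /(_ _ (m t t3)) := ha x (m x x3).
Qed.

Lemma orders_perm (s : seq nat) : s \in orders -> perm_eq s (iota 0 3).
Proof. by rewrite !inE => /or4P [|||/or3P []] /eqP ->. Qed.

Lemma three_extendable_neq (C : finType) :
  4 < #|C| -> three_extendable [rel x y : C | x != y].
Proof.
move=> C5 F o1 o2 o3 F3 F_P o1P o2P o3P o12.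
have /card_gt0P [x0 _] : 0 < #|C| by apply: leq_trans C5.
pose u1 := unzip1 F; pose u2 := unzip2 F.
pose sI := enum [pred x | (x \notin u1) && (x \notin u2)].
pose b := sI ++ enum [pred x | (x \notin u1) && (x \in u2)].
pose a := sI ++ enum [pred x | (x \in u1) && (x \notin u2)].
have memI x : (x \in sI) = (x \notin u1) && (x \notin u2) by rewrite mem_enum.
have memb x : (x \in b) = (x \notin u1).
  by rewrite mem_cat memI mem_enum inE; case: (x \in u1); case: (x \in u2).
have mema x : (x \in a) = (x \notin u2).
  by rewrite mem_cat memI mem_enum inE; case: (x \in u1); case: (x \in u2).
have b_uniq : uniq b.
  rewrite cat_uniq !enum_uniq andbT /=; apply/hasPn => x.
  by rewrite mem_enum memI inE => /andP [_ ->]; rewrite andbF.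
have a_uniq : uniq a.
  rewrite cat_uniq !enum_uniq andbT /=; apply/hasPn => x.
  by rewrite mem_enum memI inE => /andP [->].
have size_ge (s t : seq C) : uniq t -> (forall x, (x \in t) = (x \notin s)) ->
    size s <= #|C| - 3 -> 3 <= size t.
  move=> t_uniq ts s3; have := card_predC_seq s.
  have -> : #|[predC s]| = size t; last by lia.
  by rewrite -(card_uniqP t_uniq); apply: eq_card => x; rewrite ts inE.
have b3 : 3 <= size b by apply: (size_ge u1); rewrite // size_map.
have a3 : 3 <= size a by apply: (size_ge u2); rewrite // size_map.
pose m := minn 3 (size sI).
have ab i : i < m -> nth x0 b i = nth x0 a i.
  by move=> im; rewrite !nth_cat; have -> : i < size sI by lia.
have bI i : i < 3 -> nth x0 b i \notin u2 -> i < m.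
  move=> i3; rewrite nth_cat leq_min i3; case: ltnP => // ni /negP [].
  have : nth x0 (enum [pred x | (x \notin u1) && (x \in u2)]) (i - size sI)
      \in enum [pred x | (x \notin u1) && (x \in u2)].
    by apply: mem_nth; rewrite ltn_subLR // -size_cat; apply: leq_trans i3 b3.
  by rewrite mem_enum inE => /andP [].
have ba i j : i < 3 -> j < 3 -> nth x0 b i = nth x0 a j -> (i == j) && (i < m).
  move=> i3 j3 E; have im : i < m.
    by apply: bI => //; rewrite E -mema mem_nth // (leq_trans j3).
  by rewrite im andbT; move: E; rewrite ab // => /eqP; rewrite nth_uniq // (leq_trans _ a3).
(* For an absent color [index] returns [size s], which is at least 3 for both lists, so the color
   gets code 3, as do those beyond the third position. *)
pose code (s : seq C) x := minn 3 (index x s).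
have code_le s x : code s x <= 3 by apply: geq_minl.
have code_nth s x i : uniq s -> 3 <= size s -> i < 3 -> nth x0 s i = x -> code s x = i.
  by move=> s_uniq s3 i3 <-; rewrite /code index_uniq ?(leq_trans i3) //; apply/minn_idPr/ltnW.
have nth_code s x : 3 <= size s -> code s x < 3 -> nth x0 s (code s x) = x.
  move=> s3; rewrite /code gtn_min ltnn => c3; rewrite (minn_idPr (ltnW c3)).
  by rewrite nth_index // -index_mem (leq_trans c3).
pose cp (o : option (C * C)) := if o is Some x then code b x.1 else 3.
pose cr (o : option (C * C)) := if o is Some x then code a x.2 else 3.
have cp_le o : cp o <= 3 by case: o => [x|] //; apply: code_le.
have cr_le o : cr o <= 3 by case: o => [x|] //; apply: code_le.
have cpr o : (forall x, o = Some x -> x.1 != x.2) -> codes_neq m (cp o) (cr o).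
  case: o => [x|] /= h; last by rewrite /codes_neq /m; lia.
  apply/negP => /andP [/eqP E lt]; have := h x erefl.
  have lt3 : code b x.1 < 3 by apply: leq_trans lt (geq_minl _ _).
  by rewrite -(nth_code b x.1) // ab // E nth_code ?eqxx // -E.
have cp12 : distinct_codes [:: cp o1; cp o2; cp o3].
  rewrite /distinct_codes /=; case: o1 o2 o12 {o1P o2P} => [x|] // [y|] /= d12; last first.
    by have := code_le b x.1; case: (code b x.1) => [|[|[|[|]]]].
  have /andP [/eqP xy _] := d12 _ _ erefl erefl.
  have := code_le b x.1; rewrite leq_eqVlt => /orP [->//|c3].
  apply/orP; right; apply: contra_notN xy => /eqP E.
  by rewrite -(nth_code b x.1) // E nth_code // -E.
have cr12 : distinct_codes [:: cr o1; cr o2; cr o3].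
  rewrite /distinct_codes /=; case: o1 o2 o12 {o1P o2P cp12} => [x|] // [y|] /= d12; last first.
    by have := code_le a x.2; case: (code a x.2) => [|[|[|[|]]]].
  have /andP [_ /eqP xy] := d12 _ _ erefl erefl.
  have := code_le a x.2; rewrite leq_eqVlt => /orP [->//|c3].
  apply/orP; right; apply: contra_notN xy => /eqP E.
  by rewrite -(nth_code a x.2) // E nth_code // -E.
have := all_triplesP three_items_solvable (cp_le o1) (cp_le o2) (cp_le o3).
rewrite cp12 => /all_triplesP /(_ _ _ _ (cr_le o1) (cr_le o2) (cr_le o3)).
rewrite cr12 => /allP /(_ m); rewrite mem_iota ltnS geq_minl => /(_ isT).
have -> : all (fun i => codes_neq m (nth 0 [:: cp o1; cp o2; cp o3] i)
    (nth 0 [:: cr o1; cr o2; cr o3] i)) (iota 0 3) by rewrite /= !cpr.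
move=> /hasP [s /orders_perm s_perm /hasP [t /orders_perm t_perm]].
have s_uniq : uniq s by rewrite (perm_uniq s_perm) iota_uniq.
have t_uniq : uniq t by rewrite (perm_uniq t_perm) iota_uniq.
have s_size := perm_size s_perm; have t_size := perm_size t_perm.
have s_lt i : i < 3 -> nth 0 s i < 3.
  by move=> i3; have := mem_nth 0 (s := s); rewrite s_size => /(_ _ i3);
    rewrite (perm_mem s_perm) mem_iota.
have t_lt i : i < 3 -> nth 0 t i < 3.
  by move=> i3; have := mem_nth 0 (s := t); rewrite t_size => /(_ _ i3);
    rewrite (perm_mem t_perm) mem_iota.
pose q i := (nth x0 b (nth 0 s i), nth x0 a (nth 0 t i)).
have q_ok i o : i < 3 -> nth 0 s i != cp o -> nth 0 t i != cr o ->
    codes_neq m (nth 0 s i) (nth 0 t i) ->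
    [/\ (q i).1 != (q i).2, avoids F (q i) & compatible o (q i)].
  move=> i3 sp tr st; split.
  - by apply: contraNneq st => /ba ->; rewrite ?s_lt ?t_lt.
  - by rewrite /avoids -/u1 -/u2 -memb -mema !mem_nth
      ?(leq_trans (s_lt _ i3)) ?(leq_trans (t_lt _ i3)).
  - case: o sp tr => //= x sp tr; apply/andP; split=> /=.
      by apply: contraNneq sp => /code_nth ->; rewrite ?s_lt.
    by apply: contraNneq tr => /code_nth ->; rewrite ?t_lt.
have q_differ i j : i < 3 -> j < 3 -> i != j -> differ (q i) (q j).
  move=> i3 j3 ij; rewrite /differ /=.
  rewrite !(nth_uniq x0) ?(leq_trans (s_lt _ _)) ?(leq_trans (t_lt _ _)) //.
  by rewrite !nth_uniq ?s_size ?t_size // ij.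
move=> /and4P [/and3P [s0 t0 st0] /and3P [s1 t1 st1] /and3P [s2 t2 st2] _].
exists (q 0), (q 1), (q 2); rewrite !q_differ //=.
split; first exact: q_ok s0 t0 st0; split; first exact: q_ok s1 t1 st1.
by split; first exact: q_ok s2 t2 st2.
Qed.

(** For four colors [rev_ord] has no fixed point because 4 is even, and [three_extendable] is not
    requested. *)
Theorem two_degenerate_arc_coloring_ord (k : nat) (T : finType) (e : rel T) :
  4 <= k -> symmetric e -> irreflexive e -> (forall v, #|nbr e v| <= k) ->
  two_degenerate e ->
  exists c, arc_coloring [rel x y : 'I_k | x != y] e c.
Proof.
rewrite leq_eqVlt => /predU1P [<- {k}|k5] e_sym e_irr e_deg e_2deg; last first.
  apply: two_degenerate_arc_coloring; rewrite ?card_ord //.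
  - by move=> x y; rewrite /= eq_sym.
  - exact: ltnW.
  - by apply: three_extendable_two; rewrite ?card_ord //;
      apply: three_extendable_neq; rewrite card_ord.
  - by move=> _; apply: three_extendable_neq; rewrite card_ord.
have rev_neq (x : 'I_4) : x != rev_ord x by case: x => -[|[|[|[|]]]].
have [|x y /eqP -> //||||||||c [cP c_inj]] :=
    @two_degenerate_arc_coloring _ [rel x y : 'I_4 | y == rev_ord x] _ _ _ _ _ T e.
- by move=> x y /=; rewrite -(inj_eq rev_ord_inj) rev_ordK eq_sym.
- by rewrite card_ord.
- exact: two_extendable_rev_ord.
- by rewrite card_ord.
- by [].
- by [].
- by rewrite card_ord.
- by [].
by exists c; split=> // u v /cP /= /eqP ->.
Qed.

(** * From arc colorings to defective incidence colorings *)

Section Incidence.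
Variable G : sgraph.

(** The arc is recovered from the other end of the edge. The successor moves ['I_k] to the colors
    from 1 to [k], and 0 is a default value. *)
Definition incidence_color (k : nat) (c : G -> G -> 'I_k) (i : G * {set G}) : nat :=
  if [pick w in i.2 :\ i.1] is Some w then (c i.1 w).+1 else 0.

Lemma adj_neq (u v : G) : adj u v -> u != v.
Proof. by apply: contraTneq => ->; rewrite adj_irr. Qed.

Lemma incidence_color_strong k (c : G -> G -> 'I_k) u v : adj u v ->
  incidence_color c (u, [set u; v]) = (c u v).+1.
Proof.
move=> uv; rewrite /incidence_color /=; case: pickP => [w|/(_ v)].
  by rewrite !inE => /andP [wu /predU1P [E|/eqP -> //]]; rewrite E eqxx in wu.
by rewrite !inE eqxx orbT eq_sym adj_neq.
Qed.

Lemma incidence_color_weak k (c : G -> G -> 'I_k) u v : adj u v ->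
  incidence_color c (v, [set u; v]) = (c v u).+1.
Proof. by rewrite setUC adj_sym; apply: incidence_color_strong. Qed.

Lemma arc_coloring_defective k (c : G -> G -> 'I_k) :
  arc_coloring [rel x y : 'I_k | x != y] adj c ->
  defective_incidence_coloring 1 k (incidence_color c).
Proof.
move=> [cP c_inj]; split=> [[u e]|u].
  rewrite !inE /= => /andP [/imsetP [[x y]]]; rewrite inE /= => xy ->.
  by rewrite !inE => /orP [] /eqP ->; rewrite ?incidence_color_strong ?incidence_color_weak /=.
split=> [v w|v|col _].
- rewrite !inE => uv uw vw; rewrite !incidence_color_strong // eqSS.
  by case: (c_inj _ _ _ uv uw vw).
- by rewrite inE => uv; rewrite incidence_color_strong // incidence_color_weak //; apply: cP.
apply/card_le1_eqP => i j; rewrite !inE.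
move=> /andP [/imsetP [v]]; rewrite inE => uv -> /eqP <- /andP [/imsetP [w]].
rewrite inE => uw -> /eqP; have [-> //|vw] := eqVneq v w.
rewrite !incidence_color_weak // => -[/esym/val_inj E].
by have [_] := c_inj _ _ _ uv uw vw; rewrite E eqxx.
Qed.

Lemma max_degree_le_colors d k phi :
  defective_incidence_coloring (G := G) d k phi -> max_degree G <= k.
Proof.
move=> [phi_range phi_ok]; apply/bigmax_leqP => u _.
have [phi_inj _ _] := phi_ok u.
pose s := [seq phi (u, [set u; v]) | v in neighbors u].
rewrite cardE -(size_map (fun v => phi (u, [set u; v]))) -(size_iota 1 k).
apply: uniq_leq_size.
  rewrite map_inj_in_uniq ?enum_uniq // => v w; rewrite !mem_enum => uv uw E.
  by apply: contra_eq E => vw; apply: phi_inj.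
move=> x /mapP [v]; rewrite mem_enum => uv ->; rewrite mem_iota add1n ltnS; apply: phi_range.
rewrite !inE /= eqxx andbT; apply/imsetP; exists (u, v) => //.
by rewrite inE in uv; rewrite inE.
Qed.

End Incidence.

Theorem two_degenerate_chromatic_number (G : sgraph) :
  two_degenerate (adj (s := G)) -> 4 <= max_degree G ->
  defective_incidence_chromatic_number G 1 = max_degree G.
Proof.
move=> G2 k4; have [|c c_ok] := two_degenerate_arc_coloring_ord k4
    (adj_sym (s := G)) (adj_irr (s := G)) _ G2.
  by move=> v; apply: (@leq_bigmax _ (fun u : G => #|neighbors u|)).
rewrite /defective_incidence_chromatic_number.
case: ex_minnP => m /boolp.asboolP [phi /max_degree_le_colors Gm] m_min.
apply/eqP; rewrite eqn_leq Gm andbT; apply: m_min; apply/boolp.asboolP.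
by exists (incidence_color c); apply: arc_coloring_defective.
Qed.

(** * Subdivisions of K4 *)

Section SubdividedK4.
Variables (T : finType) (e : rel T).
Hypotheses (e_sym : symmetric e) (e_irr : irreflexive e).

(* A subdivision of K4 with branch vertices [a], [b := last a X], [c] and
   [d := last c Y1], where ac, bc and ad are edges and the branch path from b
   to d is an edge to the end of [Y2] followed by [Y2] backwards. *)
Definition subdivided_K4 (a : T) (X : seq T) (c : T) (Y1 Y2 : seq T) : Prop :=
  let b := last a X in let d := last c Y1 in
  [/\ path e a X, path e c (Y1 ++ Y2), uniq ((a :: X) ++ c :: Y1 ++ Y2),
      X != [::] & Y1 != [::]] /\
  [/\ e a c, e b c, e a d & e b (last d Y2)].

(** The case in which [d] comes no later than [f] on the path from [c]. That path is cut at [d] and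
    [f], and what follows [f] is dropped. *)
Lemma subdivided_K4_of_chords a X c p1 d p2 f :
  path e a X -> path e c (rcons p1 d ++ p2) ->
  uniq ((a :: X) ++ c :: rcons p1 d ++ p2) -> X != [::] ->
  e a c -> e (last a X) c -> e a d -> e (last a X) f -> f \in d :: p2 ->
  exists X' c' Y1 Y2, subdivided_K4 a X' c' Y1 Y2.
Proof.
move=> aX cp U X0 ac bc ad bf; rewrite inE => /predU1P [Ef|f2].
  exists X, c, (rcons p1 d), [::]; rewrite /subdivided_K4 !cats0 last_rcons /= -Ef.
  move: cp U; rewrite cat_path => /andP [cp _]; rewrite Ef; split; split=> //.
  - by move: U; rewrite -cat_cons catA cat_uniq => /andP [].
  - by case: (p1).
  - by rewrite -Ef.
case/path.splitP: f2 cp U => q1 q2 cp U.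
exists X, c, (rcons p1 d), (rcons q1 f); rewrite /subdivided_K4 !last_rcons; split; split=> //.
- by move: cp; rewrite catA cat_path => /andP [].
- by move: U; rewrite [rcons p1 d ++ _]catA -cat_cons catA cat_uniq => /andP [].
by case: (p1).
Qed.

Lemma rev_path_last a X : path e (last a X) (rev (belast a X)) = path e a X.
Proof. by rewrite rev_path; apply: eq_path => x y; rewrite e_sym. Qed.

Lemma last_rev_belast (a : T) X : last (last a X) (rev (belast a X)) = a.
Proof. by case: X => //= x X; rewrite rev_cons last_rcons. Qed.

Lemma rev_belastE (a : T) X : last a X :: rev (belast a X) = rev (a :: X).
Proof. by rewrite [a :: X]lastI rev_rcons. Qed.

(** If [f] comes before [d] on [Z], reversing the path [a :: X] exchanges its two ends, hence the
    two chords, and restores the order. *)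
Lemma subdivided_K4_exists a X c Z d f :
  path e a X -> path e c Z -> uniq ((a :: X) ++ c :: Z) -> X != [::] ->
  e a c -> e (last a X) c -> e a d -> e (last a X) f -> d \in Z -> f \in Z ->
  exists a' X' c' Y1 Y2, subdivided_K4 a' X' c' Y1 Y2.
Proof.
move=> aX cZ U X0 ac bc ad bf dZ; case/splitPr: dZ cZ U => p1 p2 cZ U.
rewrite mem_cat => /orP [f1|f2]; last first.
  by exists a; apply: (subdivided_K4_of_chords (p1 := p1) (p2 := p2) aX _ _ X0
      ac bc ad bf f2); rewrite cat_rcons.
case/splitPr: f1 cZ U => r1 r2; rewrite -catA cat_cons => cZ U.
exists (last a X).
apply: (@subdivided_K4_of_chords _ (rev (belast a X)) c r1 f (r2 ++ d :: p2) d) => //.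
- by rewrite rev_path_last.
- by rewrite cat_rcons.
- rewrite rev_belastE cat_rcons; move: U; rewrite !cat_uniq rev_uniq.
  by congr [&& _, _ & _]; congr (~~ _); apply: eq_has => x; rewrite /= mem_rev.
- by case: (X) X0 => // x X' _; rewrite /= rev_cons; case: rev.
- by rewrite last_rev_belast.
- by rewrite last_rev_belast.
- by rewrite inE mem_cat mem_head !orbT.
Qed.

Definition simple_path (A : {set T}) (s : seq T) : bool :=
  [&& all (mem A) s, uniq s & sorted e s].

(** The chosen longest path is [a], [X], [c], [Z], where [ac] is the shortest chord. Another chord
    at [a] must end in [Z]. Since [ac] is an edge, reversing [a :: X] gives a longest path starting
    at the last vertex of [X], which therefore has a chord into [Z] as well. *)
Lemma subdivided_K4_of_min_degree (A : {set T}) :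
  A != set0 -> (forall v, v \in A -> 2 < #|[set w in A | e v w]|) ->
  exists a X c Y1 Y2, subdivided_K4 a X c Y1 Y2.
Proof.
case/set0Pn => x0 x0A A3.
pose has_size n := [exists t : n.-tuple T, simple_path A t].
have has_sizeP s : simple_path A s -> has_size (size s).
  by move=> s_ok; apply/existsP; exists (in_tuple s).
have x0_ok : simple_path A [:: x0] by rewrite /simple_path /= x0A.
have ex_size : exists n, has_size n.
  by exists 1; apply: (has_sizeP [:: x0]).
have size_le n : has_size n -> n <= #|T|.
  case/existsP => t /and3P [_ t_uniq _].
  by rewrite -[X in X <= _](size_tuple t) -(card_uniqP t_uniq) max_card.
have [n n_size n_max] := ex_maxnP ex_size size_le.
have in_path v s w : simple_path A (v :: s) -> size (v :: s) = n ->
    w \in A -> e v w -> w \in s.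
  move=> vs_ok vs_n wA vw; apply/negPn/negP => ws.
  suff /has_sizeP/n_max : simple_path A [:: w, v & s] by rewrite /= -vs_n /= ltnn.
  case/and3P: vs_ok => /= vsA vs_uniq vs_path.
  rewrite /simple_path /= wA vsA vs_uniq vs_path inE negb_or ws e_sym vw !andbT /=.
  by apply: contraTneq vw => ->; rewrite e_irr.
pose chord i := [&& 1 < i, i < n & [exists t : n.-tuple T,
  simple_path A t && e (nth x0 t 0) (nth x0 t i)]].
have chordP s i : simple_path A s -> size s = n -> 1 < i -> i < n ->
    e (nth x0 s 0) (nth x0 s i) -> chord i.
  move=> s_ok /eqP s_n i1 i_n es; rewrite /chord i1 i_n; apply/existsP.
  by exists (Tuple s_n); rewrite s_ok.
(* Among three neighbors of [v] in [A], one is neither [w] nor the successor of [v] on the path. *)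
have far v s w : simple_path A (v :: s) -> size (v :: s) = n -> exists f,
    [/\ f \in s, e v f, f != w, 1 < index f (v :: s) & index f (v :: s) < n].
  move=> vs_ok vs_n; have vA : v \in A by case/and3P: vs_ok => /andP [].
  have /card_gt2P [f1 [f2 [f3 [[h1 h2 h3] [d12 d23 d31]]]]] := A3 v vA.
  have [f [fA vf fw fs]] : exists f, [/\ f \in A, e v f, f != w & f != head w s].
    move: h1 h2 h3; rewrite !inE => /andP [? ?] /andP [? ?] /andP [? ?].
    have [E1|n1] := eqVneq f1 w; have [E2|n2] := eqVneq f2 w.
    - by rewrite E1 E2 eqxx in d12.
    - have [E2'|n2'] := eqVneq f2 (head w s); last by exists f2.
      by exists f3; split=> //; rewrite -?E2' -?E1 // eq_sym.
    - have [E1'|n1'] := eqVneq f1 (head w s); last by exists f1.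
      by exists f3; split=> //; rewrite -?E1' -?E2 // eq_sym.
    - have [E1'|n1'] := eqVneq f1 (head w s); last by exists f1.
      by exists f2; split=> //; rewrite -?E1' // eq_sym.
  have f_s := in_path _ _ _ vs_ok vs_n fA vf.
  exists f; split=> //; last by rewrite -vs_n index_mem inE f_s orbT.
  case: s {vs_ok vs_n} fs f_s => //= y s; rewrite inE => fy _.
  have -> : v == f = false by apply: contraTF vf => /eqP ->; rewrite e_irr.
  by rewrite eq_sym (negPf fy).
have nth_idx s f : f \in s -> nth x0 s (index f s) = f by apply: nth_index.
have ex_chord : exists i, chord i.
  case/existsP: n_size => t t_ok; have t_n := size_tuple t.
  case E: (tval t) t_ok t_n => [|v s] t_ok t_n.
    by have := n_max 1 (has_sizeP _ x0_ok); rewrite -t_n.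
  have [f [fs vf _ f1 fn]] := far _ _ v t_ok t_n.
  exists (index f (v :: s)); apply: (chordP (v :: s)) => //.
  by rewrite nth_idx //= inE fs orbT.
have [i /and3P [i1 i_n /existsP [t /andP [t_ok t_chord]]] i_min] := ex_minnP ex_chord.
have t_n := size_tuple t; move: (tval t) t_n t_ok t_chord => s s_n s_ok s_chord.
have iE : i = i.-1.+1 by rewrite prednK // ltnW.
case: s s_n s_ok s_chord => [|a s] s_n s_ok; first by rewrite -s_n in i_n.
have i_s : i.-1 < size s by rewrite -ltnS -iE; move: i_n; rewrite -s_n.
have [X [c [Z [Es X_size]]]] : exists X c Z, s = X ++ c :: Z /\ size X = i.-1.
  exists (take i.-1 s), (nth x0 s i.-1), (drop i.-1.+1 s).
  by rewrite -drop_nth // cat_take_drop size_take i_s.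
rewrite iE /= Es nth_cat X_size ltnn subnn /= => ac.
move: s_n s_ok; rewrite {s i_s}Es => s_n s_ok.
have X0 : X != [::] by rewrite -size_eq0 X_size; move: i1; rewrite iE ltnS lt0n.
have [sA s_uniq s_path] := and3P s_ok.
move: (s_path); rewrite /= cat_path /= => /and3P [aX bc cZ].
(* The size of [X'] puts [c] at index [i], so a chord ending in [X'] would contradict the minimality
   of [i]. *)
have beyond v X' : size X' = size X -> simple_path A (v :: X' ++ c :: Z) ->
    exists2 f, f \in Z & e v f.
  move=> X'_size vs_ok; have vs_n : size (v :: X' ++ c :: Z) = n.
    by rewrite -s_n /= !size_cat X'_size.
  have [f [fs vf fc f1 fn]] := far _ _ c vs_ok vs_n.
  exists f => //; have : chord (index f (v :: X' ++ c :: Z)).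
    by apply: chordP vs_ok vs_n f1 fn _; rewrite nth_idx //= inE fs orbT.
  move=> /i_min; rewrite iE /=; have -> : v == f = false.
    by apply: contraTF vf => /eqP ->; rewrite e_irr.
  move: fs; rewrite mem_cat inE (negPf fc) /= index_cat; case: ifP => [fX' _|//].
  by rewrite ltnS -X_size -X'_size leqNgt index_mem fX'.
have [d dZ ad] := beyond a X erefl s_ok.
have [||f fZ bf] := beyond (last a X) (rev (belast a X)).
- by rewrite size_rev size_belast.
- rewrite /simple_path -cat_cons rev_belastE; apply/and3P; split.
  + by move: sA; rewrite -cat_cons !all_cat all_rev.
  + move: s_uniq; rewrite -cat_cons !cat_uniq rev_uniq => /and3P [-> h ->].
    by rewrite andbT (eq_has (a2 := mem (a :: X))) // => x; apply: mem_rev.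
  + rewrite -rev_belastE /= cat_path /= rev_path_last aX last_rev_belast ac.
    by [].
by apply: subdivided_K4_exists aX cZ s_uniq X0 ac bc ad bf dZ fZ.
Qed.

Lemma subdivided_K4_or_two_degenerate :
  (exists a X c Y1 Y2, subdivided_K4 a X c Y1 Y2) \/ two_degenerate e.
Proof.
have [/existsP [A /andP [A0 /forall_inP A3]]|noA] := boolP [exists A : {set T},
    (A != set0) && [forall v in A, 2 < #|[set w in A | e v w]|]].
  by left; apply: subdivided_K4_of_min_degree A0 A3.
right=> A A0; rewrite negb_exists in noA; move/forallP: noA => /(_ A).
rewrite A0 /= negb_forall_in => /exists_inP [v vA v2].
by exists v; rewrite // leqNgt.
Qed.

End SubdividedK4.

From mathcomp Require Import boolp classical_sets cardinality set_interval.
From mathcomp Require Import topology prodnormedzmodule normedtype lra.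
From Stdlib Require Import Bool Ring.

Import Order.TTheory GRing.Theory Num.Theory.
Import ProdNormedZmodule numFieldNormedType.Exports.

(** * Parity of crossings *)

(** The tactic [ring] knows the Boolean ring through [xorb]. *)
Lemma addbE : addb = xorb.
Proof. by apply/boolp.funext => -[]; apply/boolp.funext => -[]. Qed.

(** Adds two equations modulo 2; the last premise is then left to [ring]. *)
Lemma xorb_eq l1 r1 l2 r2 a b : l1 = r1 -> l2 = r2 ->
  xorb a b = xorb (xorb l1 r1) (xorb l2 r2) -> a = b.
Proof. by move=> -> ->; rewrite !xorb_nilpotent; case: a; case: b. Qed.

Section Winding.
Local Open Scope ring_scope.
Variable R : realDomainType.
Implicit Types (x y z u : R * R) (e f : seq (R * R)).

(** The convention on the first axis makes exactly one of [z] and [- z] upper whenever [z] is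
    nonzero. *)
Definition upper z : bool := (0 < z.2) || (z.2 == 0) && (0 < z.1).

(* Parity of the number of times the segment from [z] to [z'] crosses the
   negative half of the first axis, provided that some [half_plane] contains
   [z] and [z']. *)
Definition crossing z z' : bool := (z.1 < 0) && (upper z (+) upper z').

Definition half_plane (i : bool * bool) z : bool :=
  let a := if i.1 then z.1 else z.2 in if i.2 then 0 < a else a < 0.

Fixpoint winding u y f : bool :=
  if f is y' :: f' then crossing (y - u) (y' - u) (+) winding u y' f' else false.

(** The discrete form of disjointness: over one cell of the grid, the difference of the two moving
    points stays in a half-plane that misses the origin. *)
Definition separated_steps x x' y y' : bool :=
  [exists i, [&& half_plane i (y - x), half_plane i (y - x'),
                 half_plane i (y' - x) & half_plane i (y' - x')]].

Definition separated_chains x e y f : bool :=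
  path (fun x x' => path (separated_steps x x') y f) x e.

Lemma half_plane_neq0 i z : half_plane i z -> z != 0.
Proof.
by apply: contraTneq => ->; rewrite /half_plane /=; case: i => -[] [] /=; rewrite ltxx.
Qed.

Lemma upperN z : z != 0 -> upper (- z) = ~~ upper z.
Proof.
case: z => a b; rewrite /upper -pair_eqE /= !oppr_gt0 oppr_eq0 negb_and.
by case: (ltgtP b 0) => //= _; case: (ltgtP a 0).
Qed.

(** Points of the right half-plane are away from the negative half-axis, and in the upper or lower
    one [upper] is constant, so only the left half-plane allows a crossing. *)
Lemma crossing_half_plane i z z' : half_plane i z -> half_plane i z' ->
  crossing z z' = (i == (true, false)) && (upper z (+) upper z').
Proof.
rewrite /crossing /half_plane /upper; case: i => -[] [] /=.
- by move=> h _; rewrite ltNge ltW.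
- by move=> ->.
- by move=> -> ->; rewrite andbF.
- by move=> h h'; rewrite !ltNge !(ltW h) !(ltW h') !lt_eqF // andbF.
Qed.

Lemma half_planeN i z : half_plane (i.1, ~~ i.2) (- z) = half_plane i z.
Proof. by case: i => -[] []; rewrite /half_plane /= ?oppr_gt0 ?oppr_lt0. Qed.

(** In the left or right half-plane, a change of [upper] is a crossing for exactly one of the two
    segments; in the upper or lower one, both sides vanish. *)
Lemma crossingN i z z' : half_plane i z -> half_plane i z' ->
  crossing (- z) (- z') (+) crossing z z' = upper z (+) upper z'.
Proof.
move=> iz iz'; rewrite (crossing_half_plane iz iz').
rewrite (@crossing_half_plane (i.1, ~~ i.2)) ?half_planeN //.
rewrite !upperN ?(half_plane_neq0 iz) ?(half_plane_neq0 iz') // addNb addbN negbK.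
case: i iz iz' => -[] []; rewrite /= ?addbF // /half_plane /upper /=.
- by move=> -> ->.
- by move=> h h'; rewrite !ltNge !(ltW h) !(ltW h') !lt_eqF.
Qed.

(** By [crossingN] the negated terms become crossings along the two other sides of the square, up to
    [upper] terms. In a common half-plane [crossing] is a difference of values at the ends, so the
    four sides add up to zero. *)
Lemma crossing_square i z00 z01 z10 z11 : half_plane i z00 ->
  half_plane i z01 -> half_plane i z10 -> half_plane i z11 ->
  crossing z00 z10 (+) crossing z01 z11 (+)
  crossing (- z00) (- z01) (+) crossing (- z10) (- z11) =
  upper (- z00) (+) upper (- z01) (+) upper (- z10) (+) upper (- z11).
Proof.
move=> h00 h01 h10 h11.
rewrite !upperN ?(half_plane_neq0 h00) ?(half_plane_neq0 h01) ?(half_plane_neq0 h10)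
  ?(half_plane_neq0 h11) //.
rewrite -(addbK (crossing z00 z01) (crossing (- z00) _)) (crossingN h00 h01).
rewrite -(addbK (crossing z10 z11) (crossing (- z10) _)) (crossingN h10 h11).
rewrite (crossing_half_plane h00 h10) (crossing_half_plane h01 h11).
rewrite (crossing_half_plane h00 h01) (crossing_half_plane h10 h11).
move: (upper z00) (upper z01) (upper z10) (upper z11) (i == _) => b1 b2 b3 b4.
by case; case: b1; case: b2; case: b3; case: b4.
Qed.

Lemma crossing_cell x x' y y' : separated_steps x x' y y' ->
  crossing (y - x) (y' - x) (+) crossing (y - x') (y' - x') (+)
  crossing (x - y) (x' - y) (+) crossing (x - y') (x' - y') =
  upper (x - y) (+) upper (x' - y) (+) upper (x - y') (+) upper (x' - y').
Proof.
case/existsP => i /and4P [h1 h2 h3 h4].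
by have := crossing_square h1 h2 h3 h4; rewrite !opprB.
Qed.

(** [crossing_cell] is summed along [f]; the terms at an inner point occur in two consecutive cells
    and cancel. [winding_separated] repeats this along [e]. *)
Lemma winding_step x x' y f : path (separated_steps x x') y f ->
  winding x y f (+) winding x' y f (+)
  crossing (x - y) (x' - y) (+) crossing (x - last y f) (x' - last y f) =
  upper (x - y) (+) upper (x' - y) (+) upper (x - last y f) (+) upper (x' - last y f).
Proof.
rewrite addbE; elim: f y => /= [y _|y' f IHf y /andP [/crossing_cell E /IHf {}IHf]].
  by ring.
by rewrite addbE in E IHf *; apply: (xorb_eq E IHf); ring.
Qed.

Lemma winding_separated x e y f : separated_chains x e y f ->
  winding x y f (+) winding (last x e) y f (+)
  winding y x e (+) winding (last y f) x e =
  upper (x - y) (+) upper (last x e - y) (+)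
  upper (x - last y f) (+) upper (last x e - last y f).
Proof.
rewrite addbE; elim: e x => /= [x _|x' e IHe x /andP [/winding_step E /IHe {}IHe]].
  by ring.
by rewrite addbE in E IHe *; apply: (xorb_eq E IHe); ring.
Qed.

Lemma upperB x y : x != y -> upper (y - x) = xorb true (upper (x - y)).
Proof. by move=> xy; rewrite -opprB upperN // subr_eq0. Qed.

Lemma K5_not_separated (p0 p1 p2 p3 p4 : R * R)
    (e01 e02 e03 e04 e12 e13 e14 e23 e24 e34 : seq (R * R)) :
  uniq [:: p0; p1; p2; p3; p4] ->
  last p0 e01 = p1 -> last p0 e02 = p2 -> last p0 e03 = p3 -> last p0 e04 = p4 ->
  last p1 e12 = p2 -> last p1 e13 = p3 -> last p1 e14 = p4 -> last p2 e23 = p3 ->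
  last p2 e24 = p4 -> last p3 e34 = p4 ->
  separated_chains p0 e01 p2 e23 -> separated_chains p0 e01 p2 e24 ->
  separated_chains p0 e01 p3 e34 -> separated_chains p0 e02 p1 e13 ->
  separated_chains p0 e02 p1 e14 -> separated_chains p0 e02 p3 e34 ->
  separated_chains p0 e03 p1 e12 -> separated_chains p0 e03 p1 e14 ->
  separated_chains p0 e03 p2 e24 -> separated_chains p0 e04 p1 e12 ->
  separated_chains p0 e04 p1 e13 -> separated_chains p0 e04 p2 e23 ->
  separated_chains p1 e12 p3 e34 -> separated_chains p1 e13 p2 e24 ->
  separated_chains p1 e14 p2 e23 -> False.
Proof.
rewrite /= !inE !negb_or -!andbA => /and5P [n01 n02 n03 n04].
move=> /and5P [n12 n13 n14 n23 /and3P [n24 n34 _]].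
move=> l01 l02 l03 l04 l12 l13 l14 l23 l24 l34.
move=> /winding_separated H1 /winding_separated H2 /winding_separated H3.
move=> /winding_separated H4 /winding_separated H5 /winding_separated H6.
move=> /winding_separated H7 /winding_separated H8 /winding_separated H9.
move=> /winding_separated H10 /winding_separated H11 /winding_separated H12.
move=> /winding_separated H13 /winding_separated H14 /winding_separated H15.
rewrite !(l01, l02, l03, l04, l12, l13, l14, l23, l24, l34) addbE in H1 H2 H3 H4 H5
  H6 H7 H8 H9 H10 H11 H12 H13 H14 H15.
have add l r b : l = r -> b = false -> xorb (xorb l r) b = false.
  by move=> -> ->; rewrite xorb_nilpotent.
have := add _ _ _ H1 (add _ _ _ H2 (add _ _ _ H3 (add _ _ _ H4 (add _ _ _ H5
  (add _ _ _ H6 (add _ _ _ H7 (add _ _ _ H8 (add _ _ _ H9 (add _ _ _ H10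
  (add _ _ _ H11 (add _ _ _ H12 (add _ _ _ H13 (add _ _ _ H14
  (add _ _ _ H15 erefl)))))))))))))).
(* Each pair of points contributes six [upper] terms. Orienting all of them by increasing index
   flips fifteen, an odd number. *)
rewrite !(upperB n01, upperB n02, upperB n03, upperB n04, upperB n12,
  upperB n13, upperB n14, upperB n23, upperB n24, upperB n34).
by rewrite (_ : xorb _ _ = true) //; ring.
Qed.

End Winding.

(** * Plane drawings *)

Section Chains.
Local Open Scope classical_set_scope.

(** Near every point of [A] steps go both ways, so the points reachable from [p] form an open and
    closed subset of [A]. *)
Lemma connected_path (T : topologicalType) (A : set T) (step : rel T) (p q : T) :
  connected A ->
  (forall x, A x -> nbhs x (fun y => A y -> step x y && step y x)) ->
  A p -> A q -> exists2 s, path step p s & last p s = q.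
Proof.
move=> A_conn A_step Ap Aq.
pose reach := [set y | exists2 s, path step p s & last p s = y].
have reach_step x y : reach x -> step x y -> reach y.
  by move=> [s ps <-] xy; exists (rcons s y); rewrite ?last_rcons // rcons_path ps.
suff E : A `&` reach = A by have : A q by []; rewrite -E => -[].
apply: A_conn; first by exists p; split=> //; exists [::].
- exists (~` A `|` reach)°; first exact: open_interior.
  apply/seteqP; split=> x [Ax Cx]; split=> //; last first.
    by have [] := nbhs_singleton Cx.
  apply: filterS (A_step x Ax) => y xy; have [Ay|] := pselect (A y); last by left.
  by right; apply: reach_step Cx _; case/andP: (xy Ay).
- exists (~` (~` A `|` ~` reach)°); first exact/open_closedC/open_interior.
  apply/seteqP; split=> x [Ax Cx]; split=> //.
    by move=> /nbhs_singleton [].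
  apply: contrapT => Nx; apply: Cx; apply: filterS (A_step x Ax) => y xy.
  have [Ay|] := pselect (A y); last by left.
  by right=> Ry; apply: Nx; apply: reach_step Ry _; case/andP: (xy Ay).
Qed.

Local Open Scope ring_scope.
Variable R : realType.
Local Notation V := (R * R)%type.
Implicit Types (x y z p q : V) (A B : set V).

Lemma norm_pair z : `|z| = Num.max `|z.1| `|z.2|.
Proof. by rewrite prod_normE. Qed.

(** For the maximum norm, a perturbation smaller than the norm of [z] preserves the sign of a
    coordinate of largest absolute value. *)
Lemma norm_half_plane z : z != 0 ->
  exists i, forall w, `|w - z| < `|z| -> half_plane i w.
Proof.
move=> z0; rewrite norm_pair; case: leP => zz.
- have z2 : z.2 != 0.
    apply: contraNneq z0 => E; move: zz; rewrite E normr0 normr_le0 => /eqP E'.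
    by rewrite -pair_eqE /= E E' eqxx.
  exists (false, 0 < z.2) => w; rewrite norm_pair gt_max => /andP [_ /=].
  rewrite /half_plane /= ltr_distl; case: (ltgtP 0 z.2) z2 => // z2 _.
  + by rewrite gtr0_norm // subrr => /andP [].
  + by rewrite ltr0_norm // subrr => /andP [].
- have z1 : z.1 != 0 by rewrite -normr_gt0; apply: le_lt_trans zz.
  exists (true, 0 < z.1) => w; rewrite norm_pair gt_max => /andP [/= + _].
  rewrite /half_plane /= ltr_distl; case: (ltgtP 0 z.1) z1 => // z1 _.
  + by rewrite gtr0_norm // subrr => /andP [].
  + by rewrite ltr0_norm // subrr => /andP [].
Qed.

(** The slack [eta] leaves room for a step of the other chain inside [B]. *)
Definition clear_step B (eta : R) : rel V :=
  fun x y => `[< forall d, B d -> `|x - y| + eta <= `|d - y| >].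

Lemma clear_step_sub A B eta eta' : A `<=` B -> eta' <= eta ->
  subrel (clear_step B eta) (clear_step A eta').
Proof.
move=> AB ee x y /asboolP xy; apply/asboolP => d /AB/xy.
by apply: le_trans; rewrite lerD2l.
Qed.

Definition fine_step B (eta : R) : rel V :=
  fun x y => [&& x \in B, y \in B & `|x - y| < eta].

(** All four differences are closer to [d - y] than its norm, so the half-plane that
    [norm_half_plane] gives for [d - y] contains them. *)
Lemma clear_fine_separated B eta x y d d' :
  clear_step B eta x y -> fine_step B eta d d' -> separated_steps x y d d'.
Proof.
move=> /asboolP xy /and3P [/set_mem Bd _ dd]; have Bxy := xy _ Bd.
have e0 : 0 < eta by apply: le_lt_trans dd.
have dy0 : d - y != 0.
  by rewrite -normr_gt0; apply: lt_le_trans Bxy; rewrite ltr_wpDl.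
have [i i_ok] := norm_half_plane dy0; apply/existsP; exists i.
have dd' : `|d' - d| < eta by rewrite distrC.
apply/and4P; split; apply: i_ok; apply: lt_le_trans Bxy.
- by rewrite opprB addrC addrA addrNK distrC ltrDl.
- by rewrite subrr normr0 ltr_wpDl.
- have -> : d' - x - (d - y) = (y - x) + (d' - d).
    by rewrite opprB addrACA [d' + y]addrC addrACA.
  by rewrite [`|x - y|]distrC; apply: le_lt_trans (ler_normD _ _) _; rewrite ltrD2l.
- have -> : d' - y - (d - y) = d' - d by rewrite opprB addrA addrNK.
  by apply: lt_le_trans dd' _; rewrite lerDr.
Qed.

Lemma clear_fine_chains B eta x e y f :
  path (clear_step B eta) x e -> path (fine_step B eta) y f ->
  separated_chains x e y f.
Proof.
move=> xe yf; apply: sub_path xe => u v uv; apply: sub_path yf => d d'.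
exact: clear_fine_separated.
Qed.

(** Lets a finely sampled walk play the role of the clear chain against another walk at positive
    distance. *)
Lemma fine_clear A B eta r : (forall a b, A a -> B b -> r <= `|a - b|) ->
  eta + eta <= r -> subrel (fine_step A eta) (clear_step B eta).
Proof.
move=> AB er x y /and3P [_ /set_mem Ay xy]; apply/asboolP => d Bd.
rewrite [leRHS]distrC; apply: le_trans (AB _ _ Ay Bd); apply: le_trans er.
by rewrite lerD2r ltW.
Qed.

(** Each step has a slack of its own, and the path has finitely many steps. *)
Lemma clear_slack B p s : path (fun x y =>
    `[< exists2 r, `|x - y| < r & forall d, B d -> r <= `|d - y| >]) p s ->
  exists2 eta, 0 < eta & path (clear_step B eta) p s.
Proof.
elim: s p => [p _|y s IHs p /= /andP [/asboolP [r pr Br] /IHs [eta e0 ys]]].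
  by exists 1.
exists (Num.min eta (r - `|p - y|)); first by rewrite lt_min e0 subr_gt0.
apply/andP; split.
  apply/asboolP => d /Br; apply: le_trans.
  by rewrite -lerBrDl ge_min lexx orbT.
by apply: sub_path ys; apply: clear_step_sub => //; rewrite ge_min lexx.
Qed.

Lemma closed_dist B p : closed B -> ~ B p ->
  exists2 r, 0 < r & forall d, B d -> r <= `|d - p|.
Proof.
move=> /closed_openC B_open Bp.
have /nbhs_ballP [r /= r0 pr] : nbhs p (~` B) by apply: open_nbhs_nbhs.
exists r => // d Bd; rewrite leNgt; apply/negP => dr.
by apply: (pr d) => //; rewrite -ball_normE /ball_ /= distrC.
Qed.

Lemma compact_closed_dist A B : compact A -> closed B -> A `&` B = set0 ->
  exists2 r, 0 < r & forall a b, A a -> B b -> r <= `|a - b|.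
Proof.
move=> A_cpt B_cl AB.
(* Near each point of [A], half of its own bound remains valid; compactness makes the bound
   uniform. *)
have : \forall r \near 0^'+, A `<=` (fun a => forall b, B b -> r <= `|a - b|).
  apply: (compact_near_coveringP A).1 => // a Aa.
  have [|r r0 ar] := closed_dist (p := a) B_cl.
    by move=> Ba; have : (A `&` B) a by []; rewrite AB.
  near=> a' r' => b /ar; rewrite distrC => ab.
  have aa : `|a - a'| < r / 2.
    near: a'; apply: (@cvgr_dist_lt _ _ _ (nbhs a)) => //; rewrite divr_gt0 //.
  have r'r : r' <= r / 2.
    near: r'; apply: nbhs_right_le; rewrite divr_gt0 //.
  rewrite /=; have := ler_distD a' a b; lra.
move=> A_far; near (0 : R)^'+ => r; exists r => // a b Aa Bb.
by apply: (near A_far r).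
Unshelve. all: by end_near. Qed.

End Chains.

(** * Walks in an outerplanar drawing and the resulting K5 *)

Section OuterplanarDrawing.
Local Open Scope ring_scope.
Local Open Scope classical_set_scope.
Variables (R : realType) (G : sgraph) (f : plane_embedding R G).
Local Notation V := (R * R)%type.

Definition arc_set (u v : G) : set V := Defs.arc f u v @` `[0, 1].

Lemma arc_set_compact u v : adj u v -> compact (arc_set u v).
Proof.
move=> uv; apply: continuous_compact; first exact: arc_continuous.
exact: segment_compact.
Qed.

Lemma arc_set_connected u v : adj u v -> connected (arc_set u v).
Proof.
move=> uv; apply: connected_continuous_connected; last exact: arc_continuous.
exact: segment_connected.
Qed.

Lemma arc_setP u v z : arc_set u v z <-> exists2 t : R, 0 <= t <= 1 & z = Defs.arc f u v t.
Proof.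
split=> [[t /=]|[t t01 ->]]; first by rewrite in_itv /= => t01 <-; exists t.
by exists t; rewrite //= in_itv.
Qed.

Lemma arc_set_source u v : adj u v -> arc_set u v (pos f u).
Proof. by move=> uv; apply/arc_setP; exists 0; rewrite ?arc_source // lexx ler01. Qed.

Lemma arc_set_target u v : adj u v -> arc_set u v (pos f v).
Proof. by move=> uv; apply/arc_setP; exists 1; rewrite ?arc_target // lexx ler01. Qed.

Lemma arc_set_cases u v z : adj u v -> arc_set u v z ->
  [\/ z = pos f u, z = pos f v | exists2 t : R, 0 < t < 1 & z = Defs.arc f u v t].
Proof.
move=> uv /arc_setP [t /andP [t0 t1] ->].
have [->|tn0] := eqVneq t 0; first by apply: Or31; apply: arc_source.
have [->|tn1] := eqVneq t 1; first by apply: Or32; apply: arc_target.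
by apply: Or33; exists t; rewrite // !lt_neqAle t0 t1 tn1 eq_sym tn0.
Qed.

Lemma pos_notin_arc_set u v w : adj u v -> w != u -> w != v ->
  ~ arc_set u v (pos f w).
Proof.
move=> uv wu wv /(arc_set_cases uv) [/pos_inj E|/pos_inj E|[t t01 E]].
- by rewrite E eqxx in wu.
- by rewrite E eqxx in wv.
by case: (arc_pos_disjoint uv t01 (esym E)).
Qed.

Lemma arc_sets_disjoint u v x y : adj u v -> adj x y ->
  u != x -> u != y -> v != x -> v != y -> arc_set u v `&` arc_set x y = set0.
Proof.
move=> uv xy ux uy vx vy; apply/seteqP; split=> // z [z_uv z_xy].
case: (arc_set_cases uv z_uv) => [E|E|[s s01 E]].
- by apply: (pos_notin_arc_set xy ux uy); rewrite -E.
- by apply: (pos_notin_arc_set xy vx vy); rewrite -E.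
case: (arc_set_cases xy z_xy) => [E'|E'|[t t01 E']].
- by apply: (pos_notin_arc_set (w := x) uv); rewrite 1?eq_sym // -E'.
- by apply: (pos_notin_arc_set (w := y) uv); rewrite 1?eq_sym // -E'.
apply: (arc_arc_disjoint uv xy _ s01 t01 (etrans (esym E) E')).
apply: contraNneq ux => E2; have : u \in [set x; y]%SET by rewrite -E2 set21.
by rewrite !inE (negPf uy) orbF.
Qed.

Fixpoint walk_set (u : G) (p : seq G) : set V :=
  if p is v :: p' then arc_set u v `|` walk_set v p' else set0.

Lemma walk_set_compact u p : path adj u p -> compact (walk_set u p).
Proof.
elim: p u => [u _|v p IHp u /= /andP [uv /IHp vp]]; first exact: compact0.
by apply: compactU => //; apply: arc_set_compact.
Qed.

Lemma walk_set_closed u p : path adj u p -> closed (walk_set u p).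
Proof. by move/walk_set_compact; apply: compact_closed. Qed.

Lemma walk_set_drawing u p : path adj u p -> walk_set u p `<=` drawing f.
Proof.
elim: p u => [u _ z []|v p IHp u /= /andP [uv vp] z [/arc_setP z_uv|]].
  by right; exists u, v.
exact: IHp.
Qed.

Lemma pos_notin_walk_set u p w : path adj u p -> w \notin u :: p ->
  ~ walk_set u p (pos f w).
Proof.
elim: p u => [u _ _ []|v p IHp u /= /andP [uv vp]]; rewrite !inE !negb_or.
move=> /and3P [wu wv wp] [|]; first exact: pos_notin_arc_set.
by apply: IHp => //; rewrite inE negb_or wv.
Qed.

Lemma arc_walk_disjoint u v x q : adj u v -> path adj x q ->
  u \notin x :: q -> v \notin x :: q -> arc_set u v `&` walk_set x q = set0.
Proof.
move=> uv; elim: q x => [x|y q IHq x /= /andP [xy yq]]; first by rewrite setI0.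
rewrite !inE !negb_or => /and3P [ux uy uq] /and3P [vx vy vq].
rewrite setIUr arc_sets_disjoint // set0U IHq //.
- by rewrite inE negb_or uy.
- by rewrite inE negb_or vy.
Qed.

Lemma walk_sets_disjoint u p x q : path adj u p -> path adj x q ->
  ~~ has (mem (x :: q)) (u :: p) -> walk_set u p `&` walk_set x q = set0.
Proof.
move=> up xq; elim: p u up => [u _ _|v p IHp u]; first by rewrite set0I.
move=> /= /andP [uv vp] /norP [u_xq vp_xq]; have /norP [v_xq _] := vp_xq.
by rewrite setIUl (arc_walk_disjoint uv xq u_xq v_xq) set0U IHp.
Qed.

Lemma fine_chain (A : set V) p q (eta : R) : connected A -> 0 < eta -> A p -> A q ->
  exists2 s, path (fine_step A eta) p s & last p s = q.
Proof.
move=> A_conn e0; apply: connected_path => // x Ax.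
apply/nbhs_ballP; exists eta => //= y; rewrite -ball_normE /ball_ /= => xy Ay.
by rewrite /fine_step !mem_set // xy distrC xy.
Qed.

Lemma fine_step_sub (A B : set V) (eta : R) : A `<=` B ->
  subrel (fine_step A eta) (fine_step B eta).
Proof.
move=> AB x y /and3P [/set_mem Ax /set_mem Ay xy].
by rewrite /fine_step !mem_set ?xy //; apply: AB.
Qed.

Lemma walk_chain u p (eta : R) : path adj u p -> 0 < eta ->
  exists2 s, path (fine_step (walk_set u p) eta) (pos f u) s &
    last (pos f u) s = pos f (last u p).
Proof.
move=> up e0; elim: p u up => [u _|v p IHp u /= /andP [uv /IHp [s vs s_last]]].
  by exists [::].
have [s' us' s'_last] := fine_chain (arc_set_connected uv) e0
  (arc_set_source uv) (arc_set_target uv).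
exists (s' ++ s); rewrite ?last_cat ?s'_last // cat_path s'_last.
apply/andP; split.
  by apply: sub_path us'; apply: fine_step_sub; apply: subsetUl.
by apply: sub_path vs; apply: fine_step_sub; apply: subsetUr.
Qed.

Lemma drawing_closed : closed (drawing f).
Proof.
have -> : drawing f = (\bigcup_(v in [set: G]) [set pos f v]) `|`
    \bigcup_(uv in [set uv : G * G | adj uv.1 uv.2]) arc_set uv.1 uv.2.
  apply/seteqP; split=> z.
    case=> [[v ->]|[u [v [uv /arc_setP z_uv]]]]; first by left; exists v.
    by right; exists (u, v).
  case=> [[v _ ->]|[[u v] /= uv /arc_setP z_uv]]; first by left; exists v.
  by right; exists u, v.
apply: closedU; apply: closed_bigcup; try exact: finite_finset.
- by move=> v _; apply: compact_closed => //; apply: compact_set1.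
- by move=> [u v] /= uv; apply: compact_closed => //; apply: arc_set_compact.
Qed.

(** The chain stays in the face up to a point [q] closer to [pos f w] than [B] is, then jumps to
    [pos f w]. Inside the face, steps short compared with the distance to the drawing are clear of
    [B]. *)
Lemma apex_chain p (B : set V) w : (~` drawing f) p -> B `<=` drawing f ->
  closed B -> ~ B (pos f w) ->
  closure (connected_component (~` drawing f) p) (pos f w) ->
  exists2 eta, 0 < eta & exists2 s, path (clear_step B eta) p s & last p s = pos f w.
Proof.
move=> Dp BD B_cl Bw Fw; set F := connected_component _ p in Fw.
have [r r0 wr] := closed_dist B_cl Bw.
have [|q [Fq wq]] := Fw (ball (pos f w) r); first exact: nbhsx_ballx.
have F_sub : F `<=` ~` drawing f by apply: connected_component_sub.
have [s ps s_last] : exists2 s, path (fun x y =>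
    `[< exists2 r, `|x - y| < r & forall d, B d -> r <= `|d - y| >]) p s & last p s = q.
  apply: (connected_path (component_connected (A := ~` drawing f) (x := p))) => //; last first.
    exact: connected_component_refl.
  move=> x /F_sub Dx; have [e e0 xe] := closed_dist drawing_closed Dx.
  have e2 : 0 < e / 2 by rewrite divr_gt0.
  apply/nbhs_ballP; exists (e / 2) => //= y; rewrite -ball_normE /ball_ /= => xy _.
  apply/andP; split; apply/asboolP.
    exists (e / 2) => // d /BD/xe dx; have := ler_distD y d x.
    by rewrite [`|y - x|]distrC; lra.
  by exists e; [rewrite distrC; lra|move=> d /BD/xe].
have [|eta e0 p_path] := @clear_slack _ B p (rcons s (pos f w)).
  rewrite rcons_path ps s_last; apply/asboolP; exists r => //.
  by move: wq; rewrite -ball_normE /ball_ /= distrC.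
by exists eta => //; exists (rcons s (pos f w)); rewrite ?last_rcons.
Qed.

Lemma exists_common_bound (s : seq R) : all (fun r => 0 < r) s ->
  exists2 eta, 0 < eta & all (fun r => eta <= r) s.
Proof.
elim: s => [_|r s IHs /= /andP [r0 /IHs [eta e0 es]]]; first by exists 1.
exists (Num.min r eta); first by rewrite lt_min r0.
rewrite ge_min lexx /=; apply: sub_all es => t; rewrite ge_min => ->.
by rewrite orbT.
Qed.

Lemma plane_no_subdivided_K4 p (a : G) X c Y1 Y2 : (~` drawing f) p ->
  (forall v, closure (connected_component (~` drawing f) p) (pos f v)) ->
  ~ subdivided_K4 (adj (s := G)) a X c Y1 Y2.
Proof.
move=> Dp Fv [[aX cY U [X0 Y10]] [ac bc ad bf]].
set b := last a X in bc bf; set d := last c Y1 in ad bf.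
pose Z := last d Y2 :: rev (belast d Y2).
have bZ : path adj b Z.
  rewrite /= bf rev_path_last; last exact: adj_sym.
  by move: cY; rewrite cat_path => /andP [].
have Z_last : last b Z = d by rewrite /= last_rev_belast.
have cY1 : path adj c Y1 by move: cY; rewrite cat_path => /andP [].
have p_ac : path adj a [:: c] by rewrite /= ac.
have p_ad : path adj a [:: d] by rewrite /= ad.
have p_bc : path adj b [:: c] by rewrite /= bc.
have bX : b \in X by rewrite /b; case: (X) X0 => // x X' _; rewrite /= mem_last.
have dY1 : d \in Y1 by rewrite /d; case: (Y1) Y10 => // x X' _; rewrite /= mem_last.
have Zmem v : (v \in Z) = (v \in d :: Y2) by rewrite /Z rev_belastE mem_rev.
have [aX_notin X_notin [cY1_notin cY2_notin] Y1_notin] : [/\ a \notin X,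
    forall v, v \in a :: X -> [/\ v != c, v \notin Y1 & v \notin Y2],
    c \notin Y1 /\ c \notin Y2 & forall v, v \in Y1 -> v \notin Y2].
  move: U; rewrite cat_uniq !cons_uniq => /and3P [/andP [-> _] /hasPn XY /andP [c_notin Y_uniq]].
  move: c_notin Y_uniq; rewrite mem_cat negb_or cat_uniq => /andP [-> ->].
  move=> /and3P [_ /hasPn Y12 _]; split=> // v vX; last by apply: contraL vX => /Y12.
  have := contraL (XY v) vX; rewrite inE mem_cat !negb_or => /and3P [].
  by split.
have [aXc aXY1 aXY2] := X_notin a (mem_head _ _).
have [|bXc bXY1 bXY2] := X_notin b; first by rewrite inE bX orbT.
have ab : a != b by apply: contraNneq aX_notin => ->.
have cd : c != d by apply: contraNneq cY1_notin => ->.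
have dY2 := Y1_notin d dY1.
have adn : a != d by apply: contraNneq aXY1 => ->.
have bdn : b != d by apply: contraNneq bXY1 => ->.
have c_aX : c \notin a :: X by apply/negP => /X_notin []; rewrite eqxx.
have d_aX : d \notin a :: X by apply/negP => /X_notin []; rewrite dY1.
have a_bc : a \notin [:: b; c] by rewrite !inE negb_or ab.
have a_bZ : a \notin b :: Z by rewrite inE Zmem inE !negb_or ab adn.
have a_cY1 : a \notin c :: Y1 by rewrite inE negb_or aXc.
have b_ac : b \notin [:: a; c] by rewrite !inE negb_or eq_sym ab.
have b_ad : b \notin [:: a; d] by rewrite !inE negb_or eq_sym ab.
have b_cY1 : b \notin c :: Y1 by rewrite inE negb_or bXc.
have c_ad : c \notin [:: a; d] by rewrite !inE negb_or eq_sym aXc.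
have c_bZ : c \notin b :: Z by rewrite inE Zmem inE !negb_or eq_sym bXc cd.
have d_ac : d \notin [:: a; c] by rewrite !inE negb_or eq_sym adn eq_sym.
have d_bc : d \notin [:: b; c] by rewrite !inE negb_or eq_sym bdn eq_sym.
pose W := walk_set.
have W_closed u q : path adj u q -> closed (W u q) by apply: walk_set_closed.
have W_sub u q : path adj u q -> W u q `<=` drawing f by apply: walk_set_drawing.
have apex w (B1 B2 B3 : set V) : B1 `<=` drawing f -> B2 `<=` drawing f -> B3 `<=` drawing f ->
    closed B1 -> closed B2 -> closed B3 -> ~ B1 (pos f w) -> ~ B2 (pos f w) ->
    ~ B3 (pos f w) -> exists2 eta, 0 < eta & exists2 s,
    path (clear_step (B1 `|` B2 `|` B3) eta) p s & last p s = pos f w.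
  move=> D1 D2 D3 C1 C2 C3 N1 N2 N3; apply: apex_chain => //.
  - by rewrite !subUset.
  - by do 2![apply: closedU => //].
  - by case=> [[]|].
have out u q w : path adj u q -> w \notin u :: q -> ~ W u q (pos f w).
  exact: pos_notin_walk_set.
(* The chains [s1] to [s4] join [p] to [a], [b], [c], [d]; each has to be clear of the three branch
   paths that avoid its end. *)
have [e1 e1_gt0 [s1 ps1 s1_last]] := apex a (W b [:: c]) (W b Z) (W c Y1)
  (W_sub _ _ p_bc) (W_sub _ _ bZ) (W_sub _ _ cY1) (W_closed _ _ p_bc) (W_closed _ _ bZ)
  (W_closed _ _ cY1) (out _ _ _ p_bc a_bc) (out _ _ _ bZ a_bZ) (out _ _ _ cY1 a_cY1).
have [e2 e2_gt0 [s2 ps2 s2_last]] := apex b (W a [:: c]) (W a [:: d]) (W c Y1)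
  (W_sub _ _ p_ac) (W_sub _ _ p_ad) (W_sub _ _ cY1) (W_closed _ _ p_ac) (W_closed _ _ p_ad)
  (W_closed _ _ cY1) (out _ _ _ p_ac b_ac) (out _ _ _ p_ad b_ad) (out _ _ _ cY1 b_cY1).
have [e3 e3_gt0 [s3 ps3 s3_last]] := apex c (W a X) (W a [:: d]) (W b Z)
  (W_sub _ _ aX) (W_sub _ _ p_ad) (W_sub _ _ bZ) (W_closed _ _ aX) (W_closed _ _ p_ad)
  (W_closed _ _ bZ) (out _ _ _ aX c_aX) (out _ _ _ p_ad c_ad) (out _ _ _ bZ c_bZ).
have [e4 e4_gt0 [s4 ps4 s4_last]] := apex d (W a X) (W a [:: c]) (W b [:: c])
  (W_sub _ _ aX) (W_sub _ _ p_ac) (W_sub _ _ p_bc) (W_closed _ _ aX) (W_closed _ _ p_ac)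
  (W_closed _ _ p_bc) (out _ _ _ aX d_aX) (out _ _ _ p_ac d_ac) (out _ _ _ p_bc d_bc).
(* The six branch paths form three independent pairs: ab with cd, ac with bd, and ad with bc. *)
have apart u q u' q' : path adj u q -> path adj u' q' -> ~~ has (mem (u' :: q')) (u :: q) ->
    exists2 r, 0 < r & forall x y, W u q x -> W u' q' y -> r <= `|x - y|.
  move=> uq uq' h; apply: compact_closed_dist.
  - exact: walk_set_compact.
  - exact: W_closed.
  - exact: walk_sets_disjoint.
have [|r1 r1_gt0 r1_far] := apart _ _ _ _ aX cY1.
  apply/hasPn => v /X_notin [vc vY1 _]; by rewrite /= inE negb_or vc.
have [|r2 r2_gt0 r2_far] := apart _ _ _ _ p_ac bZ.
  by apply/hasPn => v; rewrite 2!inE => /orP [] /eqP ->; [exact: a_bZ|exact: c_bZ].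
have [|r3 r3_gt0 r3_far] := apart _ _ _ _ p_ad p_bc.
  by apply/hasPn => v; rewrite 2!inE => /orP [] /eqP ->; [exact: a_bc|exact: d_bc].
(* One mesh for all samplings: at most the slack of each chain from [p], and at most half the
   distance within each independent pair, as [fine_clear] requires. *)
have [|eta eta_gt0 /= /and5P [le1 le2 le3 le4 /and4P [er1 er2 er3 _]]] :=
    @exists_common_bound [:: e1; e2; e3; e4; r1 / 2; r2 / 2; r3 / 2].
  by rewrite /= e1_gt0 e2_gt0 e3_gt0 e4_gt0 !divr_gt0.
have [t12 t12_path t12_last] := walk_chain aX eta_gt0.
have [t13 t13_path t13_last] := walk_chain p_ac eta_gt0.
have [t14 t14_path t14_last] := walk_chain p_ad eta_gt0.
have [t23 t23_path t23_last] := walk_chain p_bc eta_gt0.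
have [t24 t24_path t24_last] := walk_chain bZ eta_gt0.
have [t34 t34_path t34_last] := walk_chain cY1 eta_gt0.
have apex_ok (B B' : set V) e s x t : B' `<=` B -> eta <= e ->
    path (clear_step B e) p s -> path (fine_step B' eta) x t -> separated_chains p s x t.
  move=> BB' ee ps; apply: clear_fine_chains.
  by apply: sub_path ps; apply: clear_step_sub.
have walk_ok (B B' : set V) r x s y t : (forall u v, B u -> B' v -> r <= `|u - v|) ->
    eta <= r / 2 -> path (fine_step B eta) x s -> path (fine_step B' eta) y t ->
    separated_chains x s y t.
  move=> BB' er xs; apply: clear_fine_chains; apply: sub_path xs.
  by apply: (fine_clear BB'); rewrite [leRHS]splitr lerD.
have p_pos v : p != pos f v by apply/eqP => E; apply: Dp; left; exists v.
have sub1 (B1 B2 B3 : set V) : B1 `<=` B1 `|` B2 `|` B3 by move=> z; left; left.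
have sub2 (B1 B2 B3 : set V) : B2 `<=` B1 `|` B2 `|` B3 by move=> z; left; right.
have sub3 (B1 B2 B3 : set V) : B3 `<=` B1 `|` B2 `|` B3 by move=> z; right.
apply: (@K5_not_separated _ p (pos f a) (pos f b) (pos f c) (pos f d)
  s1 s2 s3 s4 t12 t13 t14 t23 t24 t34) => //.
- rewrite /= !inE !negb_or !p_pos !(inj_eq (@pos_inj _ _ f)) ab aXc adn bXc bdn.
  by rewrite cd.
- by rewrite t24_last Z_last.
- exact: apex_ok (@sub1 _ _ _) le1 ps1 t23_path.
- exact: apex_ok (@sub2 _ _ _) le1 ps1 t24_path.
- exact: apex_ok (@sub3 _ _ _) le1 ps1 t34_path.
- exact: apex_ok (@sub1 _ _ _) le2 ps2 t13_path.
- exact: apex_ok (@sub2 _ _ _) le2 ps2 t14_path.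
- exact: apex_ok (@sub3 _ _ _) le2 ps2 t34_path.
- exact: apex_ok (@sub1 _ _ _) le3 ps3 t12_path.
- exact: apex_ok (@sub2 _ _ _) le3 ps3 t14_path.
- exact: apex_ok (@sub3 _ _ _) le3 ps3 t24_path.
- exact: apex_ok (@sub1 _ _ _) le4 ps4 t12_path.
- exact: apex_ok (@sub2 _ _ _) le4 ps4 t13_path.
- exact: apex_ok (@sub3 _ _ _) le4 ps4 t23_path.
- exact: walk_ok r1_far er1 t12_path t34_path.
- exact: walk_ok r2_far er2 t13_path t24_path.
- exact: walk_ok r3_far er3 t14_path t23_path.
Qed.

End OuterplanarDrawing.

Theorem theorem7 (R : realType) (G : sgraph) :
  outerplanar R G -> 4 <= max_degree G ->
  defective_incidence_chromatic_number G 1 = max_degree G.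
Proof.
(* The point [p] whose component is the outer face becomes the fifth vertex of K5. *)
move=> [f [F [[p Dp ->] _] Fv]]; apply: two_degenerate_chromatic_number.
have [[a [X [c [Y1 [Y2 K4]]]]]|//] :=
  subdivided_K4_or_two_degenerate (adj_sym (s := G)) (adj_irr (s := G)).
by case: (plane_no_subdivided_K4 Dp Fv K4).
Qed.
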